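(* Let $a,b,s,t$ be real numbers with $a>0$, $a+b<1$, $0<t<1$ and $t<s<1$. Then $$F_1\!\left(\tfrac32-a-b;\,1-a-b,\,1-b;\,\tfrac32-b;\ s^2,\,t^2\right)=C\cdot F_1\!\left(1-b;\,a,\,2-2a-2b;\,2-2b;\ -\frac{4t}{(1-t)^2},\,\frac{2(s-t)}{(1-t)(1+s)}\right),$$ where $C=(1-t)^{2b-2}(1+s)^{2a+2b-2}$.
   Context: The Appell hypergeometric function is $$F_1(A;B,B';c;x,y)=\sum_{m,n\ge0}\frac{(A)_{m+n}(B)_m(B')_n}{(c)_{m+n}}\frac{x^my^n}{m!\,n!}$$ for $|x|,|y|<1$, where $(q)_m=\Gamma(q+m)/\Gamma(q)$. For $\mathrm{Re}(c)>\mathrm{Re}(A)>0$ it is analytically continued to $x,y\in\mathbb{C}\setminus[1,\infty)$ by $$F_1(A;B,B';c;x,y)=\frac{\Gamma(c)}{\Gamma(A)\Gamma(c-A)}\int_0^1u^{A-1}(1-u)^{c-A-1}(1-xu)^{-B}(1-yu)^{-B'}\,du,$$ with principal branches of the powers. The function values in the claim are understood in this sense. *)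

(* Defs.v *)
From mathcomp Require Import all_boot all_order all_algebra.
From mathcomp Require Import all_classical all_reals all_analysis.
Set Implicit Arguments.
Unset Strict Implicit.
Unset Printing Implicit Defensive.
Import Order.TTheory GRing.Theory Num.Theory.
Import numFieldNormedType.Exports.
Local Open Scope classical_set_scope.
Local Open Scope ring_scope.

(* Euler's integral; it represents the Gamma function only for 0 < z. *)
Definition Gamma (R : realType) (z : R) : R :=
  Rintegral lebesgue_measure `]0, +oo[
    (fun u : R => u `^ (z - 1) * expR (- u)).

(* (q)_m; through Gamma, meaningful for 0 < q. *)
Definition pochhammer (R : realType) (q : R) (m : nat) : R :=
  Gamma (q + m%:R) / Gamma q.

(* The double series converges absolutely for |x|, |y| < 1, so that summing
   over n first and then over m is no restriction. *)
Definition appellF1_series (R : realType) (A B B' c x y : R) : R :=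
  limn (series (fun m : nat => limn (series (fun n : nat =>
    pochhammer A (m + n)%N * pochhammer B m * pochhammer B' n
      / pochhammer c (m + n)%N * (x ^+ m * y ^+ n / (m`!%:R * n`!%:R)))))).

(* For real x, y < 1 and 0 < u < 1 the bases 1 - x u and 1 - y u are positive,
   so the principal branches are the real powers. *)
Definition appellF1_integral (R : realType) (A B B' c x y : R) : R :=
  Gamma c / (Gamma A * Gamma (c - A)) *
  Rintegral lebesgue_measure `]0, 1[
    (fun u : R => u `^ (A - 1) * (1 - u) `^ (c - A - 1)
      * (1 - x * u) `^ (- B) * (1 - y * u) `^ (- B')).

(* F_1(A; B, B'; c; x, y) for positive A, B, B', c and real x, y: the series on
   its polydisc and, elsewhere with x, y < 1 and A < c, the analytic
   continuation. *)
Definition appellF1 (R : realType) (A B B' c x y : R) : R :=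
  if (`|x| < 1) && (`|y| < 1) then appellF1_series A B B' c x y
  else appellF1_integral A B B' c x y.

(* Main.v *)
Require Import Defs.
From mathcomp Require Import all_boot all_order all_algebra.
From mathcomp Require Import all_classical all_reals all_analysis.
From mathcomp Require Import measurable_realfun ring lra.
Set Implicit Arguments.
Unset Strict Implicit.
Unset Printing Implicit Defensive.
Import Order.TTheory GRing.Theory Num.Theory.
Import numFieldNormedType.Exports.
Local Open Scope classical_set_scope.
Local Open Scope ring_scope.

(** Both sides are, up to elementary factors, one and the same integral
<<
      H(s,t) = int_0^1 (1 - x^2)^-b (1 - t^2 x^2)^-a
                 ((1 - s x)^-al + (1 + s x)^-al) dx,      al = 2 - 2a - 2b.
>>
    On the right, whether its value is defined by the series or by the
    integral, it equals Euler's integral ([appellF1_series_integral]). There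
    the substitution v = (1 - w)/2 followed by the disk automorphism
    w = (x + t)/(1 + t x) carries the singular points 0, 1, -(1-t)^2/(4t),
    infinity to 1, -1, 1/t, -1/t and the remaining one to -1/s. The integral
    over ]-1, 1[ becomes H(s,t) when x and -x are paired
    ([integral_moebius_fold]).

    On the left, the double series is summed over n first. For fixed m the
    inner sum is a Gauss series, represented by Euler's integral in the
    parameter B' rather than A ([appellF1_series_dual]); the involution
    v = (1 - x^2)/(1 - t^2 x^2) turns it into the 2m-th moment of the weight
    (1 - x^2)^-b (1 - t^2 x^2)^-a ([integral_even_weight_moment]). The
    coefficients that remain are, by duplication, the even binomial
    coefficients of exponent -al ([binomial_coeff_double]), so the outer sum
    restores the even part of (1 - s x)^-al, which is again H(s,t)
    ([appellF1_series_folded]).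

    The two normalizing factors are Beta(1-b, 1/2) and Beta(1-b, 1-b). The same
    two substitutions at s = t = 0 express both of them through H(0,0)
    ([Beta_half_folded], [Beta_folded]), so that their ratio is known.

    Each substitution is made on nonnegative integrands with singular
    endpoints, where the formula is an identity in the extended reals
    ([ge0_substitution]). Each interchange of sum and integral is
    an instance of dominated convergence ([Rintegral_series]), the dominating
    function being the sum of the series of absolute values. *)

(** * Change of variables for nonnegative integrands *)

Section Substitution.
Variable R : realType.
Implicit Types (F f G : R -> R) (a b : R).
Local Notation mu := (@lebesgue_measure R).

Lemma image_segment_increasing F a b : a < b ->
  {in `[a, b] &, {homo F : x y / x < y}} -> {within `[a, b], continuous F} ->
  F @` `[a, b] = `[F a, F b]%classic.
Proof.
move=> ab incF cF.
have aab : a \in `[a, b] by rewrite in_itv/= lexx ltW.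
have bab : b \in `[a, b] by rewrite in_itv/= lexx ltW.
have leF : {in `[a, b] &, {homo F : x y / x <= y}}.
  move=> x y xab yab; rewrite le_eqVlt => /predU1P[->//|xy].
  exact/ltW/incF.
apply/seteqP; split => [_ [x /= xab <-]|].
  have /andP[ax xb] : a <= x <= b by move: xab; rewrite in_itv.
  by rewrite /= in_itv/= !leF.
exact: segment_continuous_le_surjective (ltW ab) (leF _ _ _ _ (ltW ab)) cF.
Qed.

Lemma image_segment_decreasing F a b : a < b ->
  {in `[a, b] &, {homo F : x y /~ x < y}} -> {within `[a, b], continuous F} ->
  F @` `[a, b] = `[F b, F a]%classic.
Proof.
move=> ab decF cF.
have aab : a \in `[a, b] by rewrite in_itv/= lexx ltW.
have bab : b \in `[a, b] by rewrite in_itv/= lexx ltW.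
have leF : {in `[a, b] &, {homo F : x y /~ x <= y}}.
  move=> x y xab yab; rewrite le_eqVlt => /predU1P[->//|xy].
  exact/ltW/decF.
apply/seteqP; split => [_ [x /= xab <-]|].
  have /andP[ax xb] : a <= x <= b by move: xab; rewrite in_itv.
  by rewrite /= in_itv/= !leF.
exact: segment_continuous_ge_surjective (ltW ab) (leF _ _ _ _ (ltW ab)) cF.
Qed.

Section Segment.
Variables (F f G : R -> R) (a b : R).
Hypothesis ab : a < b.
Hypothesis dF : forall x, x \in `[a, b] -> is_derive x 1 F (f x).
Hypothesis cf : forall x, x \in `[a, b] -> {for x, continuous f}.
Hypothesis cG : forall x, x \in `[a, b] -> {for F x, continuous G}.

Let sub x : x \in `]a, b[ -> x \in `[a, b].
Proof. exact: subset_itv_oo_cc. Qed.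

Let aab : a \in `[a, b]. Proof. by rewrite in_itv/= lexx ltW. Qed.
Let bab : b \in `[a, b]. Proof. by rewrite in_itv/= lexx ltW. Qed.

Let derivE x : x \in `[a, b] -> derive1 F x = f x.
Proof. by move=> xab; rewrite derive1E; have [_ ->] := dF xab. Qed.

Let cF x : x \in `[a, b] -> {for x, continuous F}.
Proof.
move=> xab; apply/differentiable_continuous/derivable1_diffP.
by have [] := dF xab.
Qed.

Let wcF : {within `[a, b], continuous F}.
Proof. by apply: continuous_in_subspaceT => x /set_mem/= /cF. Qed.

Let near_f x : x \in `]a, b[ -> \near x, f x = derive1 F x.
Proof.
move=> xab; have := near_in_itvoo xab.
by apply: filterS => y /sub yab; rewrite derivE.
Qed.

Let cderiv : {in `]a, b[, continuous (derive1 F)}.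
Proof.
move=> x xab; rewrite /continuous_at -(nbhs_singleton (near_f xab)).
by apply: cvg_trans (cf (sub xab)); apply: near_eq_cvg; exact: near_f.
Qed.

Let cderiv_right : cvg (derive1 F x @[x --> a^'+]).
Proof.
apply/cvg_ex; exists (f a).
apply: cvg_trans (cvg_at_right_filter (cf aab)).
apply: near_eq_cvg; near=> x; rewrite derivE// in_itv/=.
by apply/andP; split; near: x; [exact: nbhs_right_ge|exact: nbhs_right_le].
Unshelve. all: by end_near. Qed.

Let cderiv_left : cvg (derive1 F x @[x --> b^'-]).
Proof.
apply/cvg_ex; exists (f b).
apply: cvg_trans (cvg_at_left_filter (cf bab)).
apply: near_eq_cvg; near=> x; rewrite derivE// in_itv/=.
by apply/andP; split; near: x; [exact: nbhs_left_ge|exact: nbhs_left_le].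
Unshelve. all: by end_near. Qed.

Let dFoo : derivable_oo_LRcontinuous F a b.
Proof.
split.
- by move=> x /sub xab; have [] := dF xab.
- exact/cvg_at_right_filter/cF.
- exact/cvg_at_left_filter/cF.
Qed.

Let cG_image (I : set R) : F @` `[a, b] = I -> {within I, continuous G}.
Proof.
move=> <-; apply: continuous_in_subspaceT => y /set_mem[x xab <-].
exact: cG.
Qed.

Let increasing_substitution : (forall x, x \in `[a, b] -> 0 < f x) ->
  (\int[mu]_(x in F @` `[a, b]) (G x)%:E =
   \int[mu]_(x in `[a, b]) (G (F x) * f x)%:E)%E.
Proof.
move=> f0.
have incF : {in `[a, b] &, {homo F : x y / x < y}}.
  apply: gtr0_derive1_lt_cc => [x /sub xab|x /sub xab|]; last exact: wcF.
    by have [] := dF xab.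
  by rewrite derivE//; exact: f0.
have im := image_segment_increasing ab incF wcF.
rewrite im (@integration_by_substitution_increasing _ F G a b)//.
- by apply: eq_integral => x; rewrite inE/= => xab; rewrite !fctE derivE.
- exact: ltW.
- exact: cG_image.
Qed.

Let decreasing_substitution : (forall x, x \in `[a, b] -> f x < 0) ->
  (\int[mu]_(x in F @` `[a, b]) (G x)%:E =
   \int[mu]_(x in `[a, b]) (G (F x) * - f x)%:E)%E.
Proof.
move=> f0.
have decF : {in `[a, b] &, {homo F : x y /~ x < y}}.
  apply: ltr0_derive1_lt_cc => [x /sub xab|x /sub xab|]; last exact: wcF.
    by have [] := dF xab.
  by rewrite derivE//; exact: f0.
have im := image_segment_decreasing ab decF wcF.
rewrite im (@integration_by_substitution_decreasing _ F G a b)//.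
- by apply: eq_integral => x; rewrite inE/= => xab; rewrite !fctE derivE.
- exact: ltW.
- exact: cG_image.
Qed.

Lemma substitution_segment :
  (forall x, x \in `[a, b] -> 0 < f x) \/ (forall x, x \in `[a, b] -> f x < 0) ->
  (\int[mu]_(x in F @` `[a, b]) (G x)%:E =
   \int[mu]_(x in `[a, b]) (G (F x) * `|f x|)%:E)%E.
Proof.
move=> [] f0.
- rewrite increasing_substitution//.
  by apply: eq_integral => x /set_mem/f0/gtr0_norm ->.
- rewrite decreasing_substitution//.
  by apply: eq_integral => x /set_mem/f0/ltr0_norm ->.
Qed.

End Segment.

(** A union of increasing compact segments: the form in which an open interval,
    bounded or not, admits a reduction to segments by monotone convergence. *)
Definition segment_exhausted (D : set R) :=
  exists a b : nat -> R, [/\ forall n, a n < b n, nonincreasing_seq a,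
    nondecreasing_seq b & D = \bigcup_n `[a n, b n]%classic].

(** The formula on segments passes to the union by monotone convergence on both
    sides, so singularities of [G] at the ends of [F @` D] are allowed and both
    sides may be infinite. Taking [F @` D] as the range of the left
    integral avoids naming the image of each segment. *)
Lemma ge0_substitution (D : set R) F f G : segment_exhausted D ->
  (forall x, D x -> is_derive x 1 F (f x)) ->
  (forall x, D x -> {for x, continuous f}) ->
  (forall x, D x -> 0 < f x) \/ (forall x, D x -> f x < 0) ->
  (forall x, D x -> {for F x, continuous G}) ->
  (forall x, D x -> 0 <= G (F x)) ->
  (\int[mu]_(x in F @` D) (G x)%:E =
   \int[mu]_(x in D) (G (F x) * `|f x|)%:E)%E.
Proof.
move=> [a [b [ab ha hb DE]]] dF cf f0 cG G0.
have inD n x : x \in `[a n, b n] -> D x by move=> xab; rewrite DE; exists n.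
have cF x : D x -> {for x, continuous F}.
  move=> xD; apply/differentiable_continuous/derivable1_diffP.
  by have [] := dF x xD.
have mI n : measurable (F @` `[a n, b n]).
  apply: compact_measurable; apply: continuous_compact.
    by apply: continuous_in_subspaceT => x /set_mem/= /inD/cF.
  exact: segment_compact.
have ndI : nondecreasing_seq (fun n => `[a n, b n]%classic).
  move=> m n mn; apply/subsetPset => x /=; rewrite !in_itv/=.
  move=> /andP[h1 h2].
  by rewrite (le_trans (ha _ _ mn) h1) (le_trans h2 (hb _ _ mn)).
have lhs : (\int[mu]_(x in F @` `[a n, b n]) (G x)%:E)%E @[n --> \oo] -->
    (\int[mu]_(x in F @` D) (G x)%:E)%E.
  rewrite DE image_bigcup; apply: ge0_nondecreasing_set_cvg_integral => //.
  - move=> m n mn; apply/subsetPset; apply: image_subset.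
    by apply/subsetPset; exact: ndI.
  - move=> n; apply/measurable_EFinP.
    apply: subspace_continuous_measurable_fun => //.
    apply: continuous_in_subspaceT => y /set_mem[x xab <-].
    exact/cG/inD/xab.
  - by move=> n _ [x xab <-]; rewrite lee_fin G0//; exact: inD xab.
have rhs : (\int[mu]_(x in `[a n, b n]) (G (F x) * `|f x|)%:E)%E @[n --> \oo]
    --> (\int[mu]_(x in D) (G (F x) * `|f x|)%:E)%E.
  rewrite [X in _ --> (\int[_]_(x in X) _)%E]DE.
  apply: ge0_nondecreasing_set_cvg_integral => //.
  - move=> n; apply/measurable_EFinP.
    apply: subspace_continuous_measurable_fun => //.
    apply: continuous_in_subspaceT => x /set_mem/= /inD xD.
    apply: cvgM; last by apply: cvg_norm; exact: cf.
    by apply: continuous_comp; [exact: cF|exact: cG].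
  - by move=> n x /inD xD; rewrite lee_fin mulr_ge0 ?G0.
apply: (cvg_unique _ lhs); first exact: ereal_hausdorff.
apply: cvg_trans rhs; apply: near_eq_cvg; apply: nearW => n.
have dFn x : x \in `[a n, b n] -> is_derive x 1 F (f x) by move=> /inD/dF.
rewrite (substitution_segment (ab n) dFn)//.
- by move=> x /inD; exact: cf.
- by move=> x /inD; exact: cG.
- by case: f0 => f0; [left|right] => x /inD/f0.
Qed.

Lemma segment_exhausted_oo (l r : R) : l < r -> segment_exhausted `]l, r[.
Proof.
move=> lr; pose e n : R := (r - l) / n.+3%:R.
have rl : 0 < r - l by rewrite subr_gt0.
have e0 n : 0 < e n by rewrite divr_gt0.
have e2 n : e n < (r - l) / 2%:R.
  by rewrite ltr_pM2l// ltf_pV2 ?posrE// ltr_nat.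
have de : nonincreasing_seq e.
  by move=> m n mn; rewrite ler_pM2l// lef_pV2 ?posrE// ler_nat !ltnS.
exists (fun n => l + e n), (fun n => r - e n); split.
- by move=> n; have := e2 n; lra.
- by move=> m n /de; rewrite lerD2l.
- by move=> m n /de; rewrite lerD2l lerN2.
- apply/seteqP; split => [x /=|x [n _ /=]]; last first.
    by rewrite !in_itv/=; have := e0 n; lra.
  rewrite in_itv/= => /andP[lx xr].
  pose d := Num.min (x - l) (r - x).
  have d0 : 0 < d by rewrite lt_min !subr_gt0 lx.
  (* any n with (r - l)/n <= d puts x between l + e n and r - e n *)
  pose n := Num.trunc ((r - l) / d).
  exists n => //=.
  have : e n <= d.
    rewrite ler_pdivrMr// mulrC -ler_pdivrMr// ltW//.
    by rewrite (lt_le_trans (truncnS_gt _))// ler_nat ltnS -addn2 leq_addr.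
  by rewrite le_min in_itv/= => /andP[]; lra.
Qed.

Lemma segment_exhausted_0y : segment_exhausted (`]0, +oo[ : set R).
Proof.
exists (fun n => n.+2%:R^-1), (fun n => n.+2%:R); split.
- move=> n; apply: (@lt_trans _ _ 1); last by rewrite ltr1n.
  by rewrite invf_lt1// ltr1n.
- by move=> m n mn; rewrite lef_pV2 ?posrE// ler_nat !ltnS.
- by move=> m n mn; rewrite ler_nat !ltnS.
- apply/seteqP; split => [x /=|x [n _ /=]]; last first.
    by rewrite !in_itv/= => /andP[/(lt_le_trans _) -> //]; rewrite invr_gt0.
  rewrite in_itv/= andbT => x0.
  pose n := Num.trunc (Num.max x x^-1).
  have hn : Num.max x x^-1 < n.+2%:R.
    by rewrite (lt_trans (truncnS_gt _))// ltr_nat.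
  exists n => //=; rewrite in_itv/=; move: hn; rewrite gt_max => /andP[h1 h2].
  by rewrite (ltW h1) andbT invf_ple ?posrE// ltW.
Qed.

End Substitution.

(** * Powers, continuity and measurability *)

Section PowerFunctions.
Variable R : realType.
Implicit Types (x y p q : R) (f g : R -> R).

(** Identities between products of powers reduce to linear identities between
    logarithms through this form. *)
Lemma powR_expR x p : 0 < x -> x `^ p = expR (p * ln x).
Proof. by move=> x0; rewrite /powR gt_eqF. Qed.

Lemma continuous_at_cst (a x : R) : {for x, continuous (fun=> a)}.
Proof. exact: cvg_cst. Qed.

Lemma continuous_at_id x : {for x, continuous (fun y : R => y)}.
Proof. exact: cvg_id. Qed.

Lemma continuous_at_mul f g x : {for x, continuous f} -> {for x, continuous g} ->
  {for x, continuous (fun y => f y * g y)}.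
Proof. by move=> cf cg; apply: cvgM. Qed.

Lemma continuous_at_add f g x : {for x, continuous f} -> {for x, continuous g} ->
  {for x, continuous (fun y => f y + g y)}.
Proof. by move=> cf cg; apply: cvgD. Qed.

Lemma continuous_at_opp f x : {for x, continuous f} ->
  {for x, continuous (fun y => - f y)}.
Proof. by move=> cf; apply: cvgN. Qed.

Lemma continuous_at_inv f x : {for x, continuous f} -> f x != 0 ->
  {for x, continuous (fun y => (f y)^-1)}.
Proof. by move=> cf f0; apply: cvgV. Qed.

Lemma continuous_powR_comp f p x : {for x, continuous f} -> 0 < f x ->
  {for x, continuous (fun y => f y `^ p)}.
Proof.
move=> cf f0; apply: (@continuous_comp _ _ _ f (@powR R ^~ p)) => //.
by apply/differentiable_continuous/derivable1_diffP; have [] := is_derive1_powR p f0.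
Qed.

Lemma continuous_expR_comp f x : {for x, continuous f} ->
  {for x, continuous (fun y => expR (f y))}.
Proof.
move=> cf; apply: (@continuous_comp _ _ _ f expR) => //; exact: continuous_expR.
Qed.

Lemma continuous_exprn_comp f n x : {for x, continuous f} ->
  {for x, continuous (fun y => f y ^+ n)}.
Proof.
move=> cf; apply: (@continuous_comp _ _ _ f (fun y => y ^+ n)) => //.
exact: exprn_continuous.
Qed.

Lemma measurable_powR_comp d (T : measurableType d) (D : set T) (f : T -> R) p :
  measurable_fun D f -> measurable_fun D (fun t => f t `^ p).
Proof.
by move=> mf; apply: (@measurableT_comp _ _ _ _ _ _ (@powR R ^~ p)).
Qed.

Lemma measurable_expR_comp d (T : measurableType d) (D : set T) (f : T -> R) :
  measurable_fun D f -> measurable_fun D (fun t => expR (f t)).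
Proof. by move=> mf; exact: measurableT_comp. Qed.

Lemma measurable_opp_comp d (T : measurableType d) (D : set T) (f : T -> R) :
  measurable_fun D f -> measurable_fun D (fun t => - f t).
Proof. by move=> mf; exact: measurableT_comp. Qed.

Lemma is_derive_moebius (a b c d x : R) : c + d * x != 0 ->
  is_derive x 1 (fun y => (a + b * y) / (c + d * y))
    ((b * c - a * d) / (c + d * x) ^+ 2).
Proof.
move=> cdx.
have h (u v : R) : is_derive x 1 (fun y => u + v * y) v.
  have := is_deriveD (is_derive_cst u x 1) (is_deriveZ v (is_derive_id x 1)).
  by rewrite add0r [v *: 1]mulr1.
have hV := @is_deriveV R (fun y => c + d * y) x d 1 cdx (h c d).
have := @is_deriveM _ _ _ _ x 1 _ _ (h a b) hV.
move=> /is_derive_eq; apply; rewrite /GRing.scale/=.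
by field.
Qed.

End PowerFunctions.

Ltac measurability := repeat first
  [ exact: measurable_cst | exact: measurable_id
  | apply: measurable_powR_comp | apply: measurable_expR_comp
  | apply: measurable_funM | apply: measurable_funD | apply: measurable_funB
  | apply: measurable_funX | apply: measurable_opp_comp
  | exact: measurable_fst | exact: measurable_snd].
Ltac continuity := repeat match goal with
  | |- {for _, continuous (fun=> _)} => exact: continuous_at_cst
  | |- {for _, continuous (fun y => y)} => exact: continuous_at_id
  | |- {for _, continuous (@GRing.opp _)} => exact: opp_continuous
  | |- {for _, continuous (@GRing.mul _ ?a)} =>
      apply: (@continuous_at_mul _ (fun=> a) (fun y => y))
  | |- {for _, continuous (@GRing.add ?a)} =>
      apply: (@continuous_at_add _ (fun=> a) (fun y => y))
  | |- {for _, continuous (fun y => @powR _ _ _)} => apply: continuous_powR_comp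
  | |- {for _, continuous (fun y => @GRing.exp _ _ _)} =>
      apply: continuous_exprn_comp
  | |- {for _, continuous (fun y => expR _)} => apply: continuous_expR_comp
  | |- {for _, continuous (fun y => @GRing.inv _ _)} => apply: continuous_at_inv
  | |- {for _, continuous (fun y => @GRing.mul _ _ _)} =>
      apply: continuous_at_mul
  | |- {for _, continuous (fun y => @GRing.add _ _ _)} =>
      apply: continuous_at_add
  | |- {for _, continuous (fun y => @GRing.opp _ _)} => apply: continuous_at_opp
  end.

(** * The Gamma and Beta integrals *)

Section Tonelli.
Variable R : realType.
Local Notation mu := (@lebesgue_measure R).
Local Open Scope ereal_scope.

Lemma ge0_tonelli_set (A B : set R) (f : R -> R -> R) :
  measurable A -> measurable B ->
  measurable_fun setT (fun z : R * R => f z.1 z.2) ->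
  (forall x y, 0 <= f x y)%R ->
  \int[mu]_(x in A) \int[mu]_(y in B) (f x y)%:E =
  \int[mu]_(y in B) \int[mu]_(x in A) (f x y)%:E.
Proof.
move=> mA mB mf f0.
pose g (z : R * R) := (f z.1 z.2 * \1_A z.1 * \1_B z.2)%:E.
have mg : measurable_fun setT g.
  apply/measurable_EFinP; apply: measurable_funM; first apply: measurable_funM => //.
    by apply: measurableT_comp => //; exact: measurable_fst.
  by apply: measurableT_comp => //; exact: measurable_snd.
have g0 z : 0 <= g z by rewrite lee_fin !mulr_ge0.
have := fubini_tonelli (m1 := mu) (m2 := mu) g mg g0.
have -> : \int[mu]_x \int[mu]_y g (x, y) =
    \int[mu]_(x in A) \int[mu]_(y in B) (f x y)%:E.
  rewrite [RHS]integral_mkcond; apply: eq_integral => x _.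
  rewrite patchE; case: ifPn => xA.
    rewrite [RHS]integral_mkcond; apply: eq_integral => y _.
    rewrite patchE /g/= [\1_A x]indicE xA mulr1 indicE.
    by case: ifPn => yB; rewrite ?mulr1 ?mulr0.
  apply: integral0_eq => y _.
  by rewrite /g/= [\1_A x]indicE (negbTE xA) mulr0 mul0r.
have -> : \int[mu]_y \int[mu]_x g (x, y) =
    \int[mu]_(y in B) \int[mu]_(x in A) (f x y)%:E.
  rewrite [RHS]integral_mkcond; apply: eq_integral => y _.
  rewrite patchE; case: ifPn => yB.
    rewrite [RHS]integral_mkcond; apply: eq_integral => x _.
    rewrite patchE /g/= [\1_B y]indicE yB mulr1 indicE.
    by case: ifPn => xA; rewrite ?mulr1 ?mulr0.
  apply: integral0_eq => x _.
  by rewrite /g/= [\1_B y]indicE (negbTE yB) mulr0.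
by [].
Qed.

End Tonelli.

Section EulerIntegrals.
Variable R : realType.
Implicit Types (p q z c u : R).
Local Notation mu := (@lebesgue_measure R).

Definition gamma_weight z u : R := u `^ (z - 1) * expR (- u).
Definition beta_weight p q u : R := u `^ (p - 1) * (1 - u) `^ (q - 1).
(** Extended-real values: Tonelli's theorem gives identities between them, and
    finiteness is then deduced from those identities. *)
Definition egamma z : \bar R := (\int[mu]_(u in `]0%R, +oo[) (gamma_weight z u)%:E)%E.
Definition ebeta p q : \bar R := (\int[mu]_(u in `]0%R, 1%R[) (beta_weight p q u)%:E)%E.

Lemma gamma_weight_ge0 z u : 0 <= gamma_weight z u.
Proof. by rewrite mulr_ge0 ?powR_ge0 ?expR_ge0. Qed.

Lemma beta_weight_ge0 p q u : 0 <= beta_weight p q u.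
Proof. by rewrite mulr_ge0 ?powR_ge0. Qed.

Lemma measurable_gamma_weight D z : measurable_fun D (gamma_weight z).
Proof. by apply: measurable_funTS; rewrite /gamma_weight; measurability. Qed.

Lemma measurable_beta_weight D p q : measurable_fun D (beta_weight p q).
Proof. by apply: measurable_funTS; rewrite /beta_weight; measurability. Qed.

Lemma egamma_ge0 z : (0 <= egamma z)%E.
Proof. by apply: integral_ge0 => u _; rewrite lee_fin gamma_weight_ge0. Qed.

Lemma egamma_scale z c : 0 < c ->
  (\int[mu]_(u in `]0%R, +oo[) (u `^ (z - 1) * expR (- (c * u)))%:E =
   (c `^ (- z))%:E * egamma z)%E.
Proof.
move=> c0.
have im : ( *%R c) @` `]0, +oo[ = `]0, +oo[%classic.
  apply/seteqP; split => [_ [x /= x0 <-]|y /=].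
    by move: x0; rewrite !in_itv/= !andbT => x0; rewrite mulr_gt0.
  rewrite in_itv/= andbT => y0; exists (y / c); last by field; rewrite gt_eqF.
  by rewrite /= in_itv/= andbT divr_gt0.
have -> : egamma z = (\int[mu]_(u in ( *%R c) @` `]0%R, +oo[) (gamma_weight z u)%:E)%E.
  by rewrite im.
have dF x : (`]0, +oo[%classic : set R) x -> is_derive x 1 ( *%R c) c.
  move=> _; have := is_deriveZ c (is_derive_id x 1).
  by rewrite [c *: 1]mulr1.
rewrite (ge0_substitution (f := cst c) (segment_exhausted_0y R) dF).
- rewrite -ge0_integralZl_EFin//=.
  + apply: eq_integral => u; rewrite inE/= in_itv/= andbT => u0.
    rewrite -EFinM; congr EFin; rewrite gtr0_norm// /gamma_weight.
    rewrite !powR_expR ?mulr_gt0// lnM ?posrE//.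
    rewrite -[X in _ = _ * (_ * X)]lnK ?posrE//.
    rewrite -!expRD; congr expR; ring.
  + by move=> u _; rewrite lee_fin mulr_ge0 ?gamma_weight_ge0.
  + apply/measurable_EFinP; rewrite /gamma_weight; measurability.
  + exact: powR_ge0.
- by move=> x _; exact: cvg_cst.
- by left.
- move=> x /=; rewrite in_itv/= andbT => x0; rewrite /gamma_weight.
  by continuity; rewrite mulr_gt0.
- by move=> x _; exact: gamma_weight_ge0.
Qed.

(** Write the product as a double integral in u and w. The scaling w = u x turns
    e^(-u-w) into e^(-u(1+x)); integrating first in u leaves Gamma(p+q) times an
    integral in x, which is Beta(p,q) in the variable 1/(1+x). *)
Lemma egammaM p q : (egamma p * egamma q = egamma (p + q) * ebeta p q)%E.
Proof.
have pos u : (`]0, +oo[%classic : set R) u -> 0 < u by rewrite /= in_itv/= andbT.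
transitivity (\int[mu]_(u in `]0%R, +oo[) \int[mu]_(x in `]0%R, +oo[)
   (u `^ (p + q - 1) * x `^ (q - 1) * expR (- (u * (1 + x))))%:E)%E.
  rewrite -ge0_integralZr//=; last 3 first.
  - by apply/measurable_EFinP; exact: measurable_gamma_weight.
  - by move=> u _; rewrite lee_fin gamma_weight_ge0.
  - exact: egamma_ge0.
  apply: eq_integral => u; rewrite inE => /pos u0.
  have -> : egamma q = ((u `^ q)%:E * \int[mu]_(x in `]0%R, +oo[)
      (x `^ (q - 1) * expR (- (u * x)))%:E)%E.
    rewrite (egamma_scale q u0) muleA -EFinM !powR_expR// -expRD.
    by rewrite mulNr subrr expR0 mul1e.
  rewrite muleA -EFinM -ge0_integralZl_EFin//=.
  - apply: eq_integral => x; rewrite inE => /pos x0.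
    rewrite -EFinM; congr EFin; rewrite /gamma_weight.
    rewrite !powR_expR// -!expRD; congr expR; ring.
  - by move=> x _; rewrite lee_fin mulr_ge0 ?powR_ge0 ?expR_ge0.
  - by apply/measurable_EFinP; measurability.
  - by rewrite mulr_ge0 ?gamma_weight_ge0 ?powR_ge0.
rewrite ge0_tonelli_set//; last 2 first.
- by measurability.
- by move=> *; rewrite !mulr_ge0 ?powR_ge0 ?expR_ge0.
transitivity (\int[mu]_(x in `]0%R, +oo[)
    (egamma (p + q) * (x `^ (q - 1) * (1 + x) `^ (- (p + q)))%:E))%E.
  apply: eq_integral => x; rewrite inE => /pos x0.
  have x1 : 0 < 1 + x by rewrite addr_gt0.
  rewrite EFinM muleCA (muleC (egamma _)) -(egamma_scale _ x1).
  rewrite -ge0_integralZl_EFin//=.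
  - apply: eq_integral => u; rewrite inE => /pos u0.
    by rewrite -EFinM [_ * u]mulrC; congr EFin; ring.
  - by move=> u _; rewrite lee_fin mulr_ge0 ?powR_ge0 ?expR_ge0.
  - by apply/measurable_EFinP; measurability.
  - exact: powR_ge0.
transitivity (egamma (p + q) * \int[mu]_(x in `]0%R, +oo[)
    (x `^ (q - 1) * (1 + x) `^ (- (p + q)))%:E)%E.
  have mf : measurable_fun (`]0, +oo[%classic : set R)
      (fun x : R => (x `^ (q - 1) * (1 + x) `^ (- (p + q)))%:E).
    by apply/measurable_EFinP; measurability.
  apply: (ge0_integralZl mu (measurable_itv _) mf); last exact: egamma_ge0.
  by move=> x _; rewrite lee_fin mulr_ge0 ?powR_ge0.
congr (egamma (p + q) * _)%E; apply/esym.
pose F (x : R) := (1 + 0 * x) / (1 + 1 * x).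
have FE x : 0 < x -> F x = (1 + x)^-1 by move=> x0; rewrite /F mul0r addr0 !mul1r.
have im : F @` `]0, +oo[ = `]0, 1[%classic.
  apply/seteqP; split => [_ [x /pos x0 <-]|y /=].
    by rewrite FE//= in_itv/= invr_gt0 invf_lt1 ?addr_gt0//= ltrDl x0.
  rewrite in_itv/= => /andP[y0 y1]; exists (y^-1 - 1).
    by rewrite /= in_itv/= andbT subr_gt0 invf_gt1.
  by rewrite FE ?subr_gt0 ?invf_gt1// addrC subrK invrK.
rewrite /ebeta -im.
have dF x : (`]0, +oo[%classic : set R) x ->
    is_derive x 1 F ((0 * 1 - 1 * 1) / (1 + 1 * x) ^+ 2).
  by move=> /pos x0; apply: is_derive_moebius; rewrite mul1r gt_eqF// addr_gt0.
rewrite (ge0_substitution (segment_exhausted_0y R) dF).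
- apply: eq_integral => x; rewrite inE => /pos x0.
  have x1 : 0 < 1 + x by rewrite addr_gt0.
  congr EFin; rewrite FE// mul0r !mul1r sub0r mulN1r normrN.
  rewrite gtr0_norm ?invr_gt0 ?exprn_gt0// /beta_weight.
  have -> : 1 - (1 + x)^-1 = x * (1 + x)^-1 by field; rewrite gt_eqF.
  have -> : ((1 + x) ^+ 2)^-1 = (1 + x) `^ (- 2%:R).
    by rewrite powR_invn// ltW.
  rewrite !powR_expR ?mulr_gt0 ?invr_gt0// lnM ?posrE ?invr_gt0// !lnV ?posrE//.
  by rewrite -!expRD; congr expR; ring.
- move=> x /pos x0; continuity.
  by rewrite mul1r expf_neq0// gt_eqF// addr_gt0.
- right=> x /pos x0; rewrite mul0r mulr1 sub0r mulN1r oppr_lt0 invr_gt0.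
  by rewrite mul1r exprn_gt0// addr_gt0.
- move=> x /pos x0; rewrite /beta_weight; have x1 : 0 < 1 + x by rewrite addr_gt0.
  by continuity; rewrite FE// ?subr_gt0 ?invf_lt1 ?ltrDl ?invr_gt0.
- by move=> x _; exact: beta_weight_ge0.
Qed.

End EulerIntegrals.

Section EulerValues.
Variable R : realType.
Implicit Types (p q z c u : R).
Local Notation mu := (@lebesgue_measure R).

(** The substitution u |-> u^z turns the constant 1 into z u^(z-1). *)
Lemma ebeta_p1 z : 0 < z -> ebeta z 1 = (z^-1)%:E.
Proof.
move=> z0.
have pos u : (`]0, 1[%classic : set R) u -> 0 < u by rewrite /= in_itv/= => /andP[].
have e1 w : (1 : R) `^ w = 1 by rewrite powR1.
have im : (@powR R ^~ z) @` `]0, 1[ = `]0, 1[%classic.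
  apply/seteqP; split => [_ [x /= + <-]|y /=].
    rewrite !in_itv/= => /andP[x0 x1]; rewrite powR_gt0//=.
    by rewrite -[ltRHS](e1 z) gt0_ltr_powR// nnegrE ltW.
  rewrite in_itv/= => /andP[y0 y1]; exists (y `^ z^-1).
    rewrite /= in_itv/= powR_gt0//= -[ltRHS](e1 z^-1).
    by rewrite gt0_ltr_powR ?invr_gt0// nnegrE ltW.
  by rewrite -powRrM mulVf ?gt_eqF// powRr1 ?ltW.
have : (\int[mu]_(u in (@powR R ^~ z) @` `]0%R, 1%R[) (1 : R)%:E = 1)%E.
  rewrite im integral_cst//= mul1e; apply/eqP.
  by rewrite lebesgue_measure_itv/= lte_fin ltr01 sube0.
have dF u : (`]0, 1[%classic : set R) u ->
    is_derive u 1 (@powR R ^~ z) (z * u `^ (z - 1)).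
  by move=> /pos; exact: is_derive1_powR.
rewrite (ge0_substitution (G := fun=> 1) (segment_exhausted_oo (@ltr01 R)) dF).
- have -> : (\int[mu]_(u in `]0%R, 1%R[) (1 * `|z * u `^ (z - 1)|)%:E =
      z%:E * ebeta z 1)%E.
    rewrite -ge0_integralZl_EFin//=.
    + apply: eq_integral => u; rewrite inE => /pos u0.
      rewrite mul1r -EFinM ger0_norm ?mulr_ge0 ?powR_ge0 ?ltW//.
      by rewrite /beta_weight subrr powRr0 mulr1.
    + by move=> u _; rewrite lee_fin beta_weight_ge0.
    + by apply/measurable_EFinP; exact: measurable_beta_weight.
    + exact: ltW.
  move=> h; rewrite -[ebeta z 1]mul1e -{1}(@mulVf _ z) ?gt_eqF//.
  by rewrite EFinM -muleA h mule1.
- by move=> u /pos u0; continuity.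
- by left => u /pos u0; rewrite mulr_gt0 ?powR_gt0.
- by move=> u _; exact: cvg_cst.
- by [].
Qed.

Lemma egamma1 : egamma 1 = (1 : R)%:E.
Proof.
have pos u : (`]0, +oo[%classic : set R) u -> 0 < u by rewrite /= in_itv/= andbT.
have im : (fun u : R => expR (- u)) @` `]0, +oo[ = `]0, 1[%classic.
  apply/seteqP; split => [_ [x /pos x0 <-]|y /=].
    by rewrite /= in_itv/= expR_gt0 expR_lt1 oppr_lt0.
  rewrite in_itv/= => /andP[y0 y1]; exists (- ln y).
    by rewrite /= in_itv/= andbT oppr_gt0 ln_lt0// y0.
  by rewrite opprK lnK.
have <- : (\int[mu]_(u in (fun u : R => expR (- u)) @` `]0%R, +oo[)
    (1 : R)%:E = 1%:E)%E.
  rewrite im integral_cst//= mul1e; apply/eqP.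
  by rewrite lebesgue_measure_itv/= lte_fin ltr01 sube0.
have dF u : (`]0, +oo[%classic : set R) u ->
    is_derive u 1 (fun u : R => expR (- u)) (- expR (- u)).
  move=> _.
  have := @is_derive1_comp R expR -%R u _ _ (is_derive_expR _) (is_deriveNid _ _).
  by rewrite mulrN1.
rewrite (ge0_substitution (G := fun=> 1) (segment_exhausted_0y R) dF).
- apply: eq_integral => u _; congr EFin.
  by rewrite mul1r normrN ger0_norm ?expR_ge0// /gamma_weight subrr powRr0 mul1r.
- by move=> u _; continuity.
- by right => u _; rewrite oppr_lt0 expR_gt0.
- by move=> u _; exact: cvg_cst.
- by [].
Qed.

(** Take q = 1 in [egammaM]: Beta(z, 1) = 1/z and Gamma(1) = 1. *)
Lemma egammaS z : 0 < z -> egamma (z + 1) = (z%:E * egamma z)%E.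
Proof.
move=> z0; have := egammaM z 1; rewrite egamma1 mule1 ebeta_p1// => ->.
by rewrite muleC -muleA -EFinM mulVf ?gt_eqF// mule1.
Qed.

(** Integer arguments are finite by the functional equation, and
    u^z <= 1 + u^n for 0 <= z <= n bounds the others. *)
Lemma egamma_fin_num z : 0 < z -> egamma z \is a fin_num.
Proof.
move=> z0.
have fn n : egamma (n.+1%:R : R) \is a fin_num.
  elim: n => [|n ih]; first by rewrite egamma1.
  by rewrite -natr1 egammaS// fin_numM.
suff h : egamma (z + 1) \is a fin_num.
  have -> : egamma z = ((z^-1)%:E * egamma (z + 1))%E.
    by rewrite egammaS// muleA -EFinM mulVf ?gt_eqF// mul1e.
  by rewrite fin_numM.
pose n := Num.trunc z.
have zn : z <= n.+1%:R by rewrite ltW// truncnS_gt.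
have le : (egamma (z + 1) <= egamma 1 + egamma (n.+2%:R : R))%E.
  rewrite /egamma -ge0_integralD//=.
  - apply: ge0_le_integral => //.
    + by move=> u _; rewrite lee_fin gamma_weight_ge0.
    + by apply/measurable_EFinP; exact: measurable_gamma_weight.
    + apply: emeasurable_funD; apply/measurable_EFinP; exact: measurable_gamma_weight.
    + move=> u /=; rewrite in_itv/= andbT => u0.
      rewrite -EFinD lee_fin /gamma_weight -mulrDl ler_wpM2r ?expR_ge0//.
      rewrite addrK subrr powRr0 -natr1 addrK.
      have [u1|/ltW u1] := lerP u 1.
        rewrite (@le_trans _ _ 1)//; last by rewrite lerDl powR_ge0.
        rewrite powR_expR// -expR0 ler_expR; apply: mulr_ge0_le0; first exact: ltW.
        exact: ln_le0.
      by rewrite (le_trans (ler_powR u1 zn))// lerDr.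
  - by move=> u _; rewrite lee_fin gamma_weight_ge0.
  - by apply/measurable_EFinP; exact: measurable_gamma_weight.
  - by move=> u _; rewrite lee_fin gamma_weight_ge0.
  - by apply/measurable_EFinP; exact: measurable_gamma_weight.
rewrite ge0_fin_numE ?egamma_ge0//; apply: (le_lt_trans le).
have fs : (egamma 1 + egamma (n.+2%:R : R))%E \is a fin_num.
  by rewrite fin_numD; apply/andP; split; [exact: (fn 0%N)|exact: fn].
by rewrite ltey_eq fs.
Qed.

Lemma GammaE z : 0 < z -> (Gamma z)%:E = egamma z.
Proof. by move=> z0; rewrite -[RHS]fineK ?egamma_fin_num. Qed.

Lemma Gamma_gt0 z : 0 < z -> 0 < Gamma z.
Proof.
move=> z0; rewrite -lte_fin GammaE//.
(* a lower bound of the integrand on ]1, 2[, where 0 <= ln u <= 1 and u <= 2 *)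
pose c := expR (- (`|z - 1| + 2%:R)).
have sub : `]1, 2[%classic `<=` (`]0, +oo[%classic : set R).
  by move=> u /=; rewrite !in_itv/= andbT => /andP[/(lt_trans ltr01)].
apply: (@lt_le_trans _ _ (\int[mu]_(u in `]1%R, 2%R[) c%:E)%E).
  rewrite integral_cst//=.
  have -> : lebesgue_measure (`]1%R, 2%R[%classic : set R) = 1%E.
    by rewrite lebesgue_measure_itv/= lte_fin ltr1n/= -EFinB; congr EFin; ring.
  by rewrite mule1 lte_fin expR_gt0.
apply: (@le_trans _ _ (\int[mu]_(u in `]1%R, 2%R[) (gamma_weight z u)%:E)%E).
  apply: ge0_le_integral => //.
  - by move=> u _; rewrite lee_fin expR_ge0.
  - by apply/measurable_EFinP; exact: measurable_gamma_weight.
  - move=> u /=; rewrite in_itv/= => /andP[u1 u2].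
    have u0 : 0 < u by exact: lt_trans u1.
    rewrite lee_fin /gamma_weight powR_expR// -expRD ler_expR.
    have l0 : 0 <= ln u by rewrite ln_ge0// ltW.
    have l1 : ln u <= 1.
      by have := le_ln1Dx (x := u - 1); rewrite subrKC => /(_ _)/le_trans; apply; lra.
    have : `|(z - 1) * ln u| <= `|z - 1|.
      by rewrite normrM ler_piMr// ger0_norm.
    by rewrite ler_norml => /andP[h _]; lra.
apply: ge0_subset_integral => //.
- by apply/measurable_EFinP; exact: measurable_gamma_weight.
- by move=> u _; rewrite lee_fin gamma_weight_ge0.
Qed.

Lemma GammaS z : 0 < z -> Gamma (z + 1) = z * Gamma z.
Proof.
by move=> z0; apply: EFin_inj; rewrite EFinM !GammaE ?addr_gt0// egammaS.
Qed.

Definition Beta p q : R := \int[mu]_(u in `]0, 1[) beta_weight p q u.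

Lemma ebeta_Gamma p q : 0 < p -> 0 < q ->
  ebeta p q = (Gamma p * Gamma q / Gamma (p + q))%:E.
Proof.
move=> p0 q0; have pq0 := addr_gt0 p0 q0.
have := egammaM p q; rewrite -!GammaE// -EFinM => h.
rewrite mulrC EFinM h muleA -EFinM mulVf ?mul1e//.
by rewrite gt_eqF ?Gamma_gt0.
Qed.

Lemma Beta_Gamma p q : 0 < p -> 0 < q ->
  Beta p q = Gamma p * Gamma q / Gamma (p + q).
Proof. by move=> p0 q0; rewrite /Beta /Rintegral -/(ebeta p q) ebeta_Gamma. Qed.

Lemma Beta_gt0 p q : 0 < p -> 0 < q -> 0 < Beta p q.
Proof.
by move=> p0 q0; rewrite Beta_Gamma// divr_gt0 ?mulr_gt0 ?Gamma_gt0 ?addr_gt0.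
Qed.

Lemma integrable_beta_weight p q : 0 < p -> 0 < q ->
  mu.-integrable `]0, 1[ (EFin \o beta_weight p q).
Proof.
move=> p0 q0; apply/integrableP; split.
  by apply/measurable_EFinP; exact: measurable_beta_weight.
under eq_integral do rewrite gee0_abs ?lee_fin ?beta_weight_ge0//.
by rewrite -/(ebeta p q) ebeta_Gamma// ltry.
Qed.

Lemma integrable_gamma_weight z : 0 < z ->
  mu.-integrable `]0, +oo[ (EFin \o gamma_weight z).
Proof.
move=> z0; apply/integrableP; split.
  by apply/measurable_EFinP; exact: measurable_gamma_weight.
under eq_integral do rewrite gee0_abs ?lee_fin ?gamma_weight_ge0//.
by rewrite -/(egamma z) -GammaE// ltry.
Qed.

Lemma Gamma_scale z c : 0 < z -> 0 < c ->
  mu.-integrable `]0, +oo[ (fun u => (u `^ (z - 1) * expR (- (c * u)))%:E) /\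
  \int[mu]_(u in `]0, +oo[) (u `^ (z - 1) * expR (- (c * u))) =
  c `^ (- z) * Gamma z.
Proof.
move=> z0 c0.
have h := egamma_scale z c0; rewrite -GammaE// -EFinM in h.
split; last by rewrite /Rintegral h.
apply/integrableP; split; first by apply/measurable_EFinP; measurability.
under eq_integral do rewrite gee0_abs ?lee_fin ?mulr_ge0 ?powR_ge0 ?expR_ge0//.
by rewrite h ltry.
Qed.

End EulerValues.

(** * Series under the integral sign *)

Section SeriesOfIntegrals.
Context d (T : measurableType d) (R : realType) (mu : {measure set T -> \bar R}).
Variables (D : set T) (f : nat -> T -> R) (S M : T -> R).
Hypothesis mD : measurable D.
Hypothesis mf : forall n, measurable_fun D (f n).
Hypothesis mS : measurable_fun D S.
Hypothesis iM : mu.-integrable D (EFin \o M).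
Hypothesis fM : forall x n, D x -> \sum_(0 <= k < n) `|f k x| <= M x.
Hypothesis fS : forall x, D x -> series (f ^~ x) @ \oo --> S x.

Let mfE n : measurable_fun D (EFin \o f n).
Proof. exact/measurable_EFinP. Qed.

Let intf n : mu.-integrable D (EFin \o f n).
Proof.
apply: (le_integrable mD (mfE n) _ iM) => x Dx /=.
rewrite lee_fin [leRHS]ger0_norm; last first.
  by have := fM 0 Dx; rewrite big_geq.
apply: le_trans (fM n.+1 Dx); rewrite big_nat_recr//= lerDr.
by apply: sumr_ge0.
Qed.

Let Rintegral_partial_sum n : mu.-integrable D (fun x => (series (f ^~ x) n)%:E) /\
  \int[mu]_(x in D) (series (f ^~ x) n) =
  series (fun k => \int[mu]_(x in D) f k x) n.
Proof.
elim: n => [|n [ihi ih]].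
  have E x : series (f ^~ x) 0 = 0 by rewrite /series/= big_geq.
  split.
    by under eq_fun do rewrite E; exact: integrable0.
  rewrite /series/= [RHS]big_geq//; under eq_Rintegral do rewrite big_geq//.
  by rewrite Rintegral_cst// mul0r.
have E x : series (f ^~ x) n.+1 = series (f ^~ x) n + f n x.
  by rewrite /series/= big_nat_recr.
split.
  under eq_fun do rewrite E EFinD.
  exact: (integrableD mD ihi (intf n)).
under eq_Rintegral do rewrite E.
by rewrite RintegralD// ih /series/= [RHS]big_nat_recr.
Qed.

(** Dominated convergence for the partial sums, which [M] bounds together with
    their sums of absolute values. *)
Lemma Rintegral_series : mu.-integrable D (EFin \o S) /\
  series (fun n => \int[mu]_(x in D) f n x) @ \oo --> \int[mu]_(x in D) S x.
Proof.
pose F n x : \bar R := (series (f ^~ x) n)%:E.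
have mF n : measurable_fun D (F n).
  by have [/integrableP[]] := Rintegral_partial_sum n.
have mSE : measurable_fun D (EFin \o S) by exact/measurable_EFinP.
have FS : {ae mu, forall x, D x -> F ^~ x @ \oo --> (EFin \o S) x}.
  by apply: aeW => x Dx; apply: cvg_EFin; [exact: nearW|exact: fS].
have FM : {ae mu, forall x n, D x -> (`|F n x| <= (EFin \o M) x)%E}.
  apply: aeW => x n Dx; rewrite /F /= lee_fin.
  exact: le_trans (ler_norm_sum _ _ _) (fM n Dx).
have [iS _ cS] := dominated_convergence mD mF mSE FS iM FM.
split => //.
have /fine_cvg : (\int[mu]_(x in D) F n x)%E @[n --> \oo] -->
    (\int[mu]_(x in D) S x)%:E.
  by rewrite /Rintegral fineK//; exact: integrable_fin_num.
apply: cvg_trans; apply: near_eq_cvg; near=> n.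
by have [_ <-] := Rintegral_partial_sum n.
Unshelve. all: by end_near. Qed.

End SeriesOfIntegrals.

Section BinomialSeries.
Variable R : realType.
Implicit Types (be z y u : R).
Local Notation mu := (@lebesgue_measure R).

Lemma nneg_series_le (a : nat -> R) (l : R) n : (forall k, 0 <= a k) ->
  series a @ \oo --> l -> \sum_(0 <= k < n) a k <= l.
Proof.
move=> a0 al.
have /cvg_lim <- // := al.
apply: (@nondecreasing_cvgn_le _ (series a)); last by apply/cvg_ex; exists l.
apply/nondecreasing_seqP => k.
by rewrite /series/= big_nat_recr//= lerDl.
Qed.

Definition binomial_coeff be n : R := pochhammer be n / n`!%:R.

Lemma pochhammer_gt0 be n : 0 < be -> 0 < pochhammer be n.
Proof. by move=> b0; rewrite divr_gt0 ?Gamma_gt0// ltr_wpDr. Qed.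

Lemma binomial_coeff_ge0 be n : 0 < be -> 0 <= binomial_coeff be n.
Proof. by move=> b0; rewrite divr_ge0// ltW ?pochhammer_gt0. Qed.

Lemma cvg_expR_series z : series (exp_coeff z) @ \oo --> expR z.
Proof. exact: is_cvg_series_exp_coeff. Qed.

(** Expand e^(zu) in the Gamma integral that represents (1-z)^-be: the n-th term
    integrates to Gamma(be+n) z^n / n!, which brings in the Pochhammer symbol as
    a ratio of Gamma values. *)
Lemma binomial_series be z : 0 < be -> `|z| < 1 ->
  series (fun n => binomial_coeff be n * z ^+ n) @ \oo --> (1 - z) `^ (- be).
Proof.
move=> b0 z1.
have pos u : (`]0, +oo[%classic : set R) u -> 0 < u by rewrite /= in_itv/= andbT.
have G0 := Gamma_gt0 b0.
have scale x : x < 1 -> mu.-integrable `]0, +oo[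
      (EFin \o (fun u => u `^ (be - 1) * expR (- ((1 - x) * u)))) /\
    \int[mu]_(u in `]0, +oo[) (u `^ (be - 1) * expR (- ((1 - x) * u))) =
    (1 - x) `^ (- be) * Gamma be.
  by move=> x1; apply: Gamma_scale => //; rewrite subr_gt0.
have termE x u n : gamma_weight be u * exp_coeff (x * u) n =
    x ^+ n / n`!%:R * (gamma_weight be u * u ^+ n).
  by rewrite /exp_coeff/= exprMn; ring.
have E x u : u `^ (be - 1) * expR (- ((1 - x) * u)) =
    gamma_weight be u * expR (x * u).
  by rewrite /gamma_weight -mulrA -expRD; congr (_ * expR _); ring.
have [] := @Rintegral_series _ _ R mu `]0, +oo[%classic
  (fun n u => gamma_weight be u * exp_coeff (z * u) n)
  (fun u => u `^ (be - 1) * expR (- ((1 - z) * u)))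
  (fun u => u `^ (be - 1) * expR (- ((1 - `|z|) * u))).
- exact: measurable_itv.
- move=> n; rewrite /exp_coeff; apply: measurable_funM.
    exact: measurable_gamma_weight.
  by apply: measurable_funTS; measurability.
- by apply: measurable_funTS; measurability.
- by have [] := scale _ z1.
- move=> u n /pos u0; rewrite E.
  under eq_bigr do rewrite normrM ger0_norm ?gamma_weight_ge0//.
  rewrite -mulr_sumr ler_wpM2l ?gamma_weight_ge0//.
  have zu0 : 0 <= `|z| * u by rewrite mulr_ge0// ltW.
  have e0 k : 0 <= exp_coeff (`|z| * u) k.
    by rewrite /exp_coeff/= divr_ge0 ?exprn_ge0.
  apply: (le_trans _ (nneg_series_le n e0 (@cvg_expR_series (`|z| * u)))).
  apply: ler_sum => k _; rewrite /exp_coeff/= normrM normrX normrM.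
  by rewrite (gtr0_norm u0) [`|_^-1|]ger0_norm.
- move=> u /pos u0; rewrite E.
  have -> : series (fun n => gamma_weight be u * exp_coeff (z * u) n) =
      (fun n => gamma_weight be u * series (exp_coeff (z * u)) n).
    by apply/funext => n; rewrite /series/= mulr_sumr.
  by apply: cvgM; [exact: cvg_cst|exact: cvg_expR_series].
move=> _ h.
have z1' : z < 1 by rewrite (le_lt_trans (ler_norm z)).
move: h; have [_ ->] := scale _ z1' => h.
have -> : series (fun n => binomial_coeff be n * z ^+ n) = (fun n =>
    (Gamma be)^-1 * series (fun n => \int[mu]_(u in `]0, +oo[)
      (gamma_weight be u * exp_coeff (z * u) n)) n).
  apply/funext => n; rewrite /series/= mulr_sumr; apply: eq_bigr => k _.
  under eq_Rintegral do rewrite termE.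
  have wE u : u \in (`]0, +oo[%classic : set R) ->
      gamma_weight be u * u ^+ k = gamma_weight (be + k%:R) u.
    rewrite inE => /pos u0; rewrite -powR_mulrn ?ltW// /gamma_weight.
    by rewrite !powR_expR// -!expRD; congr expR; ring.
  have ik : 0 < be + k%:R by rewrite ltr_wpDr.
  rewrite RintegralZl//; last first.
    have := integrable_gamma_weight ik; apply: eq_integrable => //.
    by move=> u uD /=; rewrite wE.
  have -> : \int[mu]_(u in `]0, +oo[) (gamma_weight be u * u ^+ k) =
      Gamma (be + k%:R) by exact: eq_Rintegral.
  rewrite /binomial_coeff /pochhammer.
  by ring.
have -> : (1 - z) `^ (- be) = (Gamma be)^-1 * ((1 - z) `^ (- be) * Gamma be).
  by field; rewrite gt_eqF.
by apply: cvgM; [exact: cvg_cst|exact: h].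
Qed.

(** On ]0, 1[ the partial sums are bounded by |w(v)| (1 - |y|)^-be, so integrating
    the binomial series against any integrable [w] is legitimate. *)
Lemma Rintegral_binomial (w : R -> R) be y : 0 < be -> `|y| < 1 ->
  mu.-integrable `]0, 1[ (EFin \o w) ->
  mu.-integrable `]0, 1[ (EFin \o (fun v => w v * (1 - y * v) `^ (- be))) /\
  series (fun n => binomial_coeff be n * y ^+ n *
    \int[mu]_(v in `]0, 1[) (w v * v ^+ n)) @ \oo -->
  \int[mu]_(v in `]0, 1[) (w v * (1 - y * v) `^ (- be)).
Proof.
move=> b0 y1 iw.
have mw : measurable_fun (`]0, 1[%classic : set R) w.
  by have /integrableP[/measurable_EFinP] := iw.
have in01 v : (`]0, 1[%classic : set R) v -> 0 < v < 1 by rewrite /= in_itv.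
have ivn n : mu.-integrable `]0, 1[ (EFin \o (fun v => w v * v ^+ n)).
  apply: (le_integrable _ _ _ iw) => //.
    by apply/measurable_EFinP; apply: measurable_funM => //; measurability.
  move=> v /in01/andP[/ltW v0 /ltW v1]; rewrite /= lee_fin normrM.
  by rewrite ler_piMr// ger0_norm ?exprn_ge0// exprn_ile1.
have [] := @Rintegral_series _ _ R mu `]0, 1[%classic
  (fun n v => binomial_coeff be n * y ^+ n * (w v * v ^+ n))
  (fun v => w v * (1 - y * v) `^ (- be))
  (fun v => (1 - `|y|) `^ (- be) * `|w v|).
- exact: measurable_itv.
- move=> n; apply: measurable_funM => //.
  by apply: measurable_funM => //; measurability.
- by apply: measurable_funM => //; apply: measurable_funTS; measurability.
- have := integrable_norm iw.
  move=> /integrableZl => /(_ _ ((1 - `|y|) `^ (- be))) h.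
  by have := h (measurable_itv _); apply: eq_integrable.
- move=> v n /in01/andP[/ltW v0 /ltW v1].
  have y1' : `| `|y| | < 1 by rewrite normr_id.
  rewrite mulrC.
  apply: (@le_trans _ _ (`|w v| * \sum_(0 <= k < n) (binomial_coeff be k * `|y| ^+ k))).
    rewrite mulr_sumr; apply: ler_sum => k _.
    rewrite 2!normrM (ger0_norm (binomial_coeff_ge0 _ _))// normrM normrX.
    have c0 : 0 <= binomial_coeff be k * `|y| ^+ k.
      by apply: mulr_ge0; [exact: binomial_coeff_ge0|exact: exprn_ge0].
    rewrite mulrCA ler_wpM2l// ler_piMr//.
    by rewrite ger0_norm ?exprn_ge0// exprn_ile1.
  rewrite ler_wpM2l//; apply: nneg_series_le; last exact: binomial_series.
  by move=> k; apply: mulr_ge0; [exact: binomial_coeff_ge0|exact: exprn_ge0].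
- move=> v /in01/andP[/ltW v0 /ltW v1].
  have -> : series (fun n => binomial_coeff be n * y ^+ n * (w v * v ^+ n)) =
      (fun n => w v * series (fun n => binomial_coeff be n * (y * v) ^+ n) n).
    apply/funext => n; rewrite /series/= mulr_sumr; apply: eq_bigr => k _.
    by rewrite exprMn; ring.
  apply: cvgM; first exact: cvg_cst.
  apply: binomial_series => //.
  by rewrite normrM (ger0_norm v0) (le_lt_trans _ y1)// ler_piMr.
move=> iS h; split => //.
apply: cvg_trans h; apply: near_eq_cvg; apply: nearW => n.
by rewrite /series/=; apply: eq_bigr => k _; rewrite RintegralZl.
Qed.

End BinomialSeries.

(** * Integral representations of the Appell series *)

Section AppellSeries.
Variable R : realType.
Implicit Types (A B c x y p q v : R).
Local Notation mu := (@lebesgue_measure R).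

Lemma beta_weight_moment p q (m : nat) v : 0 < v < 1 ->
  beta_weight p q v * v ^+ m = beta_weight (p + m%:R) q v.
Proof.
move=> /andP[v0 _]; rewrite /beta_weight -powR_mulrn ?ltW// mulrAC -powRD.
  by congr (_ `^ _ * _); ring.
by rewrite (gt_eqF v0) implybT.
Qed.

Lemma integrable_beta_weight_moment p q (m : nat) : 0 < p -> 0 < q ->
  mu.-integrable `]0, 1[ (EFin \o (fun v => beta_weight p q v * v ^+ m)).
Proof.
move=> p0 q0; have pm : 0 < p + m%:R by rewrite ltr_wpDr.
have := integrable_beta_weight pm q0; apply: eq_integrable => //.
by move=> v; rewrite inE/= in_itv/= => v01; rewrite beta_weight_moment.
Qed.

Lemma Rintegral_beta_weight_moment p q (m : nat) :
  \int[mu]_(v in `]0, 1[) (beta_weight p q v * v ^+ m) = Beta (p + m%:R) q.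
Proof.
apply: eq_Rintegral => v; rewrite inE/= in_itv/= => v01.
by rewrite beta_weight_moment.
Qed.

Lemma series_scale_cvg (k : R) (a b : nat -> R) l :
  (forall n, b n = k * a n) -> series a @ \oo --> l -> series b @ \oo --> k * l.
Proof.
move=> bE al.
have -> : series b = (fun n => k * series a n).
  by apply/funext => n; rewrite /series/= mulr_sumr; apply: eq_bigr.
by apply: cvgM; [exact: cvg_cst|exact: al].
Qed.

(** The quotient (A)_(m+n) / (c)_(m+n) is a normalized Beta value, the moment of
    order m + n of Euler's weight. *)
Lemma appellF1_term_Euler A B B' c x y m n : 0 < A -> A < c -> 0 < B -> 0 < B' ->
  pochhammer A (m + n)%N * pochhammer B m * pochhammer B' n
    / pochhammer c (m + n)%N * (x ^+ m * y ^+ n / (m`!%:R * n`!%:R)) =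
  Gamma c / (Gamma A * Gamma (c - A)) * (binomial_coeff B m * x ^+ m) *
  (binomial_coeff B' n * y ^+ n * Beta (A + (m + n)%:R) (c - A)).
Proof.
move=> A0 Ac B0 B'0; have c0 := lt_trans A0 Ac.
have cA0 : 0 < c - A by rewrite subr_gt0.
have G (z : R) : 0 < z -> Gamma z != 0 by move=> z0; rewrite gt_eqF ?Gamma_gt0.
have f0 k : (k`!%:R : R) != 0 by rewrite pnatr_eq0 -lt0n fact_gt0.
have Amn : 0 < A + (m + n)%:R by rewrite ltr_wpDr.
have cmn : 0 < c + (m + n)%:R by rewrite ltr_wpDr.
rewrite Beta_Gamma//.
have -> : A + (m + n)%:R + (c - A) = c + (m + n)%:R by ring.
rewrite /binomial_coeff /pochhammer.
move: (G _ A0); move: (Gamma A) => gA gA0.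
move: (G _ B0); move: (Gamma B) => gB gB0.
move: (G _ B'0); move: (Gamma B') => gB' gB'0.
move: (G _ c0); move: (Gamma c) => gc gc0.
move: (G _ cA0); move: (Gamma (c - A)) => gcA gcA0.
move: (G _ cmn); move: (Gamma (c + (m + n)%:R)) => gcmn gcmn0.
move: (Gamma (A + (m + n)%:R)) => gAmn.
move: (Gamma (B + m%:R)) => gBm.
move: (Gamma (B' + n%:R)) => gBn.
move: (x ^+ m) (y ^+ n) => xm yn.
move: (f0 m) (f0 n); move: (m`!%:R : R) (n`!%:R : R) => fm fn fm0 fn0.
by field; rewrite fm0 fn0 gA0 gB0 gB'0 gc0 gcA0 gcmn0.
Qed.

(** Both binomial factors of Euler's integrand may be expanded under the
    integral sign, the inner one in [y] and the outer one in [x]. *)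
Lemma appellF1_series_integral A B B' c x y : 0 < A -> A < c -> 0 < B -> 0 < B' ->
  `|x| < 1 -> `|y| < 1 ->
  appellF1_series A B B' c x y = appellF1_integral A B B' c x y.
Proof.
move=> A0 Ac B0 B'0 x1 y1; have cA0 : 0 < c - A by rewrite subr_gt0.
set K := Gamma c / (Gamma A * Gamma (c - A)).
pose w v := beta_weight A (c - A) v * (1 - y * v) `^ (- B').
have [iw _] := Rintegral_binomial B'0 y1 (integrable_beta_weight A0 cA0).
have inner m : limn (series (fun n : nat =>
    pochhammer A (m + n)%N * pochhammer B m * pochhammer B' n
      / pochhammer c (m + n)%N * (x ^+ m * y ^+ n / (m`!%:R * n`!%:R)))) =
    K * (binomial_coeff B m * x ^+ m * \int[mu]_(v in `]0, 1[) (w v * v ^+ m)).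
  rewrite mulrA.
  have [_ h] := Rintegral_binomial B'0 y1 (integrable_beta_weight_moment m A0 cA0).
  have -> : \int[mu]_(v in `]0, 1[) (w v * v ^+ m) = \int[mu]_(v in `]0, 1[)
     (beta_weight A (c - A) v * v ^+ m * (1 - y * v) `^ (- B')).
    by apply: eq_Rintegral => v _; rewrite /w mulrAC.
  apply/cvg_lim => //; move: h; apply: series_scale_cvg => n.
  rewrite appellF1_term_Euler//; congr (_ * (_ * _)).
  rewrite -Rintegral_beta_weight_moment; apply: eq_Rintegral => v _.
  by rewrite -mulrA exprD.
rewrite /appellF1_series; under [X in limn (series X)]eq_fun do rewrite inner.
have [_ h] := Rintegral_binomial B0 x1 iw.
rewrite /appellF1_integral -/K.
have -> : \int[mu]_(u in `]0, 1[) (u `^ (A - 1) * (1 - u) `^ (c - A - 1) *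
    (1 - x * u) `^ (- B) * (1 - y * u) `^ (- B')) =
    \int[mu]_(v in `]0, 1[) (w v * (1 - x * v) `^ (- B)).
  by apply: eq_Rintegral => v _; rewrite /w /beta_weight mulrAC.
by apply/cvg_lim => //; move: h; apply: series_scale_cvg.
Qed.

(** Reading (B')_n / (c)_(m+n) as a Beta value, with m in its second argument,
    leaves (A)_(m+n) = (A)_m (A+m)_n to the binomial series of exponent -(A+m). *)
Lemma appellF1_term_dual A B B' c x y m n : 0 < A -> 0 < B -> 0 < B' -> B' < c ->
  pochhammer A (m + n)%N * pochhammer B m * pochhammer B' n
    / pochhammer c (m + n)%N * (x ^+ m * y ^+ n / (m`!%:R * n`!%:R)) =
  pochhammer A m * pochhammer B m / (pochhammer (c - B') m * m`!%:R) * x ^+ m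
    / Beta B' (c - B') *
  (binomial_coeff (A + m%:R) n * y ^+ n * Beta (B' + n%:R) (c - B' + m%:R)).
Proof.
move=> A0 B0 B'0 Bc; have c0 := lt_trans B'0 Bc.
have cB0 : 0 < c - B' by rewrite subr_gt0.
have G (z : R) : 0 < z -> Gamma z != 0 by move=> z0; rewrite gt_eqF ?Gamma_gt0.
have f0 k : (k`!%:R : R) != 0 by rewrite pnatr_eq0 -lt0n fact_gt0.
have Am : 0 < A + m%:R by rewrite ltr_wpDr.
have cm : 0 < c - B' + m%:R by rewrite ltr_wpDr.
have Bn : 0 < B' + n%:R by rewrite ltr_wpDr.
have cmn : 0 < c + (m + n)%:R by rewrite ltr_wpDr.
rewrite !Beta_Gamma//.
have -> : B' + n%:R + (c - B' + m%:R) = c + (m + n)%:R by rewrite natrD; ring.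
have -> : B' + (c - B') = c by ring.
rewrite /binomial_coeff /pochhammer.
have -> : A + m%:R + n%:R = A + (m + n)%:R by rewrite natrD; ring.
move: (G _ A0); move: (Gamma A) => gA gA0.
move: (G _ B0); move: (Gamma B) => gB gB0.
move: (G _ B'0); move: (Gamma B') => gB' gB'0.
move: (G _ c0); move: (Gamma c) => gc gc0.
move: (G _ cB0); move: (Gamma (c - B')) => gcB gcB0.
move: (G _ cmn); move: (Gamma (c + (m + n)%:R)) => gcmn gcmn0.
move: (G _ Am); move: (Gamma (A + m%:R)) => gAm gAm0.
move: (G _ cm); move: (Gamma (c - B' + m%:R)) => gcm gcm0.
move: (Gamma (A + (m + n)%:R)) => gAmn.
move: (Gamma (B + m%:R)) => gBm.
move: (Gamma (B' + n%:R)) => gBn.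
move: (x ^+ m) (y ^+ n) => xm yn.
move: (f0 m) (f0 n); move: (m`!%:R : R) (n`!%:R : R) => fm fn fm0 fn0.
by field; rewrite fm0 fn0 gA0 gB0 gB'0 gc0 gcB0 gcmn0 gAm0 gcm0.
Qed.

(** For fixed m the inner sum is a Gauss hypergeometric series, symmetric in its
    upper parameters; Euler's integral is taken in the parameter B'. *)
Lemma appellF1_series_dual A B B' c x y : 0 < A -> 0 < B -> 0 < B' -> B' < c ->
  `|y| < 1 ->
  appellF1_series A B B' c x y = limn (series (fun m : nat =>
    pochhammer A m * pochhammer B m / (pochhammer (c - B') m * m`!%:R) * x ^+ m
    / Beta B' (c - B') * \int[mu]_(v in `]0, 1[)
      (beta_weight B' (c - B' + m%:R) v * (1 - y * v) `^ (- (A + m%:R))))).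
Proof.
move=> A0 B0 B'0 Bc y1; have cB0 : 0 < c - B' by rewrite subr_gt0.
rewrite /appellF1_series; congr (limn (series _)); apply/funext => m.
have Am : 0 < A + m%:R by rewrite ltr_wpDr.
have cm : 0 < c - B' + m%:R by rewrite ltr_wpDr.
have [_ h] := Rintegral_binomial Am y1 (integrable_beta_weight B'0 cm).
apply/cvg_lim => //; move: h; apply: series_scale_cvg => n.
by rewrite appellF1_term_dual// Rintegral_beta_weight_moment.
Qed.

End AppellSeries.

(** * The even weight and its moments *)

Section EvenWeight.
Variable R : realType.
Implicit Types (a b q s t x v k al : R).
Local Notation mu := (@lebesgue_measure R).

(** Transfers a scaling relation from extended-real to real integrals; it also
    yields integrability on the side where it was unknown. *)
Lemma Rintegral_of_integral_scale (D1 D2 : set R) (f1 f2 : R -> R) k :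
  measurable D1 -> 0 < k ->
  measurable_fun D2 f2 -> (forall x, D2 x -> 0 <= f2 x) ->
  mu.-integrable D1 (EFin \o f1) ->
  (\int[mu]_(x in D1) (f1 x)%:E = k%:E * \int[mu]_(x in D2) (f2 x)%:E)%E ->
  mu.-integrable D2 (EFin \o f2) /\
  \int[mu]_(x in D1) f1 x = k * \int[mu]_(x in D2) f2 x.
Proof.
move=> mD1 k0 mf2 f20 if1 E.
have E2 : (\int[mu]_(x in D2) (f2 x)%:E =
    (k^-1 * \int[mu]_(x in D1) f1 x)%:E)%E.
  rewrite EFinM /Rintegral fineK; last exact: integrable_fin_num.
  by rewrite E muleA -EFinM mulVf ?mul1e ?gt_eqF.
split.
  apply/integrableP; split; first exact/measurable_EFinP.
  under eq_integral => x /set_mem xD do rewrite gee0_abs ?lee_fin ?f20//.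
  by rewrite E2 ltry.
by rewrite [in RHS]/Rintegral E2/=; field; rewrite gt_eqF.
Qed.

Definition even_weight a b q x : R :=
  (1 - x ^+ 2) `^ (- b) * (1 - q * x ^+ 2) `^ (- a).

Lemma measurable_even_weight D a b q : measurable_fun D (even_weight a b q).
Proof. by apply: measurable_funTS; rewrite /even_weight; measurability. Qed.

Lemma even_weight_ge0 a b q x : 0 <= even_weight a b q x.
Proof. by rewrite mulr_ge0 ?powR_ge0. Qed.

(** The map u |-> (1 - u)/(1 - q u) is an involution of ]0, 1[; applied to u = x^2
    it gives 1 - v = x^2 (1-q)/(1 - q x^2) and 1 - q v = (1-q)/(1 - q x^2). The
    integer m then enters only through x^(2m), and the power of 1 - q does not
    depend on it. This is Euler's transformation of the Gauss function. *)
Lemma integral_even_weight_moment a b q (m : nat) : 0 <= q < 1 ->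
  (\int[mu]_(v in `]0%R, 1%R[) (beta_weight (1 - b) (2^-1 + m%:R) v *
     (1 - q * v) `^ (- (3%:R / 2%:R - a - b + m%:R)))%:E =
  (2%:R * (1 - q) `^ (a + b - 1))%:E *
  \int[mu]_(x in `]0%R, 1%R[) (even_weight a b q x * x ^+ m.*2)%:E)%E.
Proof.
move=> /andP[q0 q1].
have q1' : 0 < 1 - q by rewrite subr_gt0.
have in01 x : (`]0, 1[%classic : set R) x -> 0 < x < 1 by rewrite /= in_itv.
pose M y : R := (1 + (- 1) * y) / (1 + (- q) * y).
pose F x := M (x * x).
have den y : 0 < y < 1 -> 0 < 1 - q * y.
  by move=> /andP[y0 y1]; nra.
have ME y : 0 < y < 1 -> M y = (1 - y) / (1 - q * y).
  by move=> _; rewrite /M mulN1r mulNr.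
have M01 y : 0 < y < 1 -> 0 < M y < 1.
  move=> y01; have d0 := den _ y01; rewrite ME// divr_gt0//=; last by move: y01; lra.
  by rewrite ltr_pdivrMr// mul1r; move: y01; nra.
have MK y : 0 < y < 1 -> M (M y) = y.
  move=> y01; rewrite [LHS]ME ?M01// ME//; have d0 := den _ y01.
  by field; rewrite !gt_eqF//; nra.
have sq01 x : 0 < x < 1 -> 0 < x * x < 1 by move=> /andP[x0 x1]; apply/andP; split; nra.
have im : F @` `]0, 1[ = `]0, 1[%classic.
  apply/seteqP; split => [_ [x /in01 x01 <-]|v /in01 v01].
    by rewrite /= in_itv/= M01// sq01.
  have /andP[M0 M1] := M01 _ v01.
  (* M is an involution *)
  exists (Num.sqrt (M v)).
    by rewrite /= in_itv/= sqrtr_gt0 M0/= -[ltRHS]sqrtr1 ltr_sqrt.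
  by rewrite /F -expr2 sqr_sqrtr ?ltW// MK.
pose f x := (((- 1) * 1 - 1 * (- q)) / (1 + (- q) * (x * x)) ^+ 2) * (x * 1 + x * 1).
have dF x : (`]0, 1[%classic : set R) x -> is_derive x 1 F (f x).
  move=> /in01/sq01/den d0.
  have hM : is_derive (x * x) 1 M
      (((- 1) * 1 - 1 * (- q)) / (1 + (- q) * (x * x)) ^+ 2).
    by apply: is_derive_moebius; rewrite mulNr gt_eqF.
  have hs := is_deriveM (is_derive_id x 1) (is_derive_id x 1).
  exact: (@is_derive1_comp _ M (fun x => x * x) _ _ _ hM hs).
rewrite -[X in (\int[mu]_(v in X) _)%E = _]im.
rewrite (ge0_substitution (segment_exhausted_oo (@ltr01 R)) dF (G := fun v =>
  beta_weight (1 - b) (2^-1 + m%:R) v *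
     (1 - q * v) `^ (- (3%:R / 2%:R - a - b + m%:R)))).
- rewrite -ge0_integralZl_EFin//=; last 3 first.
  + by move=> x _; rewrite lee_fin mulr_ge0 ?even_weight_ge0// exprn_even_ge0// odd_double.
  + apply/measurable_EFinP; apply: measurable_funM; last by measurability.
    exact: measurable_even_weight.
  + by rewrite mulr_ge0 ?powR_ge0.
  apply: eq_integral => x; rewrite inE => /in01 x01.
  have y01 := sq01 _ x01; have d0 := den _ y01.
  rewrite -EFinM; congr EFin; rewrite /f /F ME// /beta_weight /even_weight.
  have [x0 x1] := andP x01.
  have y1 : 0 < 1 - x * x by move: y01; lra.
  have -> : 1 - (1 - x * x) / (1 - q * (x * x)) =
      x * x * (1 - q) * (1 - q * (x * x))^-1.
    by field; rewrite gt_eqF.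
  have -> : 1 - q * ((1 - x * x) / (1 - q * (x * x))) =
      (1 - q) * (1 - q * (x * x))^-1.
    by field; rewrite gt_eqF.
  have -> : `|((- 1) * 1 - 1 * (- q)) / (1 + (- q) * (x * x)) ^+ 2 *
      (x * 1 + x * 1)| = 2%:R * (1 - q) * x * (1 - q * (x * x)) `^ (- 2%:R).
    rewrite powR_invn ?ltW// !mulr1 mulNr mul1r opprK.
    have -> : (-1 + q) / (1 - q * (x * x)) ^+ 2 * (x + x) =
      - (2%:R * (1 - q) * x * (1 - q * (x * x)) ^- 2).
      by field; rewrite gt_eqF.
    by rewrite normrN gtr0_norm// !mulr_gt0// invr_gt0 exprn_gt0.
  rewrite -!expr2 in y1 d0 *.
  rewrite -[x ^+ m.*2]powR_mulrn ?ltW//.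
  have -> : 2%:R * (1 - q) * x = 2%:R * ((1 - q) `^ 1 * x `^ 1).
    by rewrite !powRr1 ?ltW// mulrA.
  have xy : x ^+ 2 = x `^ 2%:R by rewrite powR_mulrn ?ltW.
  rewrite xy in y1 d0 *.
  have y0 : 0 < x `^ 2%:R by rewrite powR_gt0.
  have ly : ln (x `^ 2%:R) = 2%:R * ln x by rewrite ln_powR.
  move: (x `^ 2%:R) y0 ly y1 d0 => y y0 ly y1 d0.
  rewrite !powR_expR ?mulr_gt0 ?invr_gt0//.
  rewrite !lnM ?posrE ?mulr_gt0 ?invr_gt0//.
  rewrite !lnV ?posrE// ly.
  rewrite mulrCA; rewrite -!mulrA; congr (2%:R * _); rewrite -!expRD; congr expR.
  by rewrite -muln2 natrM; field.
- move=> x /in01/sq01/den d0; rewrite /f.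
  by continuity; rewrite mulNr expf_neq0// gt_eqF.
- right => x /in01 x01; have d0 := den _ (sq01 _ x01); have [x0 _] := andP x01.
  rewrite /f pmulr_llt0; last by rewrite mulr1 addr_gt0.
  rewrite pmulr_llt0; first by lra.
  by rewrite invr_gt0 exprn_gt0// mulNr.
- move=> x /in01/sq01/M01/[dup] /andP[v0 v1] /den d0; rewrite /beta_weight.
  by continuity => //; rewrite subr_gt0.
- by move=> x _; rewrite mulr_ge0 ?beta_weight_ge0 ?powR_ge0.
Qed.

End EvenWeight.

(** * The left-hand side as a folded integral *)

Section EvenPart.
Variable R : realType.
Implicit Types (a b q s t x al : R).
Local Notation mu := (@lebesgue_measure R).

Lemma pochhammer0 x : 0 < x -> pochhammer x 0 = 1.
Proof. by move=> x0; rewrite /pochhammer addr0 divff// gt_eqF ?Gamma_gt0. Qed.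

Lemma pochhammerS x (m : nat) : 0 < x ->
  pochhammer x m.+1 = (x + m%:R) * pochhammer x m.
Proof.
move=> x0; rewrite /pochhammer -natr1 addrA GammaS ?mulrA//.
by rewrite ltr_wpDr.
Qed.

Lemma binomial_coeffS x (m : nat) : 0 < x ->
  binomial_coeff x m.+1 = (x + m%:R) / (m%:R + 1) * binomial_coeff x m.
Proof.
move=> x0; rewrite /binomial_coeff pochhammerS// factS natrM -natr1.
have f0 : (m`!%:R : R) != 0 by rewrite pnatr_eq0 -lt0n fact_gt0.
have m1 : m%:R + 1 != 0 :> R by rewrite natr1 pnatr_eq0.
move: f0 m1; move: (m`!%:R : R) (m%:R : R) (pochhammer x m) => f r p f0 r0.
by field; rewrite r0 f0.
Qed.

(** Legendre's duplication for Pochhammer symbols: (al)_(2m) and (2m)! both split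
    into two symbols of order m, with a common factor 4^m. *)
Lemma binomial_coeff_double al (m : nat) : 0 < al ->
  pochhammer ((al + 1) / 2%:R) m * pochhammer (al / 2%:R) m /
    (pochhammer 2^-1 m * m`!%:R) = binomial_coeff al m.*2.
Proof.
move=> al0.
have h1 : 0 < (al + 1) / 2%:R by rewrite divr_gt0// addr_gt0.
have h2 : 0 < al / 2%:R by rewrite divr_gt0.
have h3 : 0 < (2^-1 : R) by rewrite invr_gt0.
elim: m => [|m ih].
  by rewrite /binomial_coeff !pochhammer0// fact0 !mulr1 invr1.
rewrite doubleS !binomial_coeffS// -ih -[m.*2.+1%:R]natr1 !pochhammerS// factS.
have -> : m.*2%:R = 2%:R * m%:R :> R by rewrite -natrM mul2n.
have -> : (m.+1 * m`!)%:R = (m%:R + 1) * m`!%:R :> R by rewrite natrM natr1.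
have m0 : 0 <= m%:R :> R by [].
have f0 : (m`!%:R : R) != 0 by rewrite pnatr_eq0 -lt0n fact_gt0.
have p0 : pochhammer 2^-1 m != 0 :> R by rewrite gt_eqF ?pochhammer_gt0.
move: f0 p0; move: (m`!%:R : R) (pochhammer 2^-1 m) => f p fne pne.
move: (pochhammer _ _) (pochhammer _ _) => u v.
move: (m%:R : R) m0 => r r0.
have r2 : 0 <= 2%:R * r by rewrite mulr_ge0.
have h5 : 2%:R * r + 1 != 0 by rewrite lt0r_neq0// ltr_wpDl.
have h6 : 2%:R * r + 1 + 1 != 0 by rewrite lt0r_neq0// addr_gt0// ltr_wpDl.
have h7 : r + 1 != 0 by rewrite lt0r_neq0// ltr_wpDl.
by field; rewrite fne pne h5 h6 h7.
Qed.

Lemma cvg_double_oo : (fun n : nat => n.*2) @ \oo --> \oo.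
Proof.
apply/cvgnyPge => A; near=> n.
rewrite -addnn (@leq_trans n)// ?leq_addr//; near: n.
exact: nbhs_infty_ge.
Unshelve. all: by end_near. Qed.

(** Odd terms cancel in the sum of the two series, and the partial sums of the
    even ones are the partial sums of that sum at even indices. *)
Lemma even_series_cvg (c e : nat -> R) x (l1 l2 : R) :
  series (fun n => c n * x ^+ n * e n) @ \oo --> l1 ->
  series (fun n => c n * (- x) ^+ n * e n) @ \oo --> l2 ->
  series (fun m => 2%:R * (c m.*2 * x ^+ m.*2 * e m.*2)) @ \oo --> l1 + l2.
Proof.
move=> h1 h2; have h := cvg_comp _ _ (@cvg_double_oo) (cvgD h1 h2).
suff -> : series (fun m => 2%:R * (c m.*2 * x ^+ m.*2 * e m.*2)) =
    fun n => series (fun n => c n * x ^+ n * e n) n.*2 +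
             series (fun n => c n * (- x) ^+ n * e n) n.*2 by exact: h.
apply/funext; elim=> [|n ih]; first by rewrite /series/= !big_geq// addr0.
rewrite [LHS]big_nat_recr//= [X in X + _]ih /series/= !big_nat_recr//=.
have sg : (- x) ^+ n.*2 = x ^+ n.*2 by rewrite -mul2n !exprM sqrrN.
by rewrite !exprS sg; ring.
Qed.

(** The integral to which both sides of the transformation reduce; it is the
    integral over ]-1, 1[ of the weight times (1 + s x)^-(2 - 2a - 2b), with x and
    -x paired. *)
Definition folded_integral a b s t : R :=
  \int[mu]_(x in `]0, 1[) (even_weight a b (t ^+ 2) x *
    ((1 - s * x) `^ (- (2%:R - 2%:R * a - 2%:R * b)) +
     (1 + s * x) `^ (- (2%:R - 2%:R * a - 2%:R * b)))).

Section LeftHandSide.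
Variables a b s t : R.
Hypotheses (ha : 0 < a) (hab : a + b < 1).
Hypotheses (s1 : `|s| < 1) (t1 : `|t| < 1).
Let al : R := 2%:R - 2%:R * a - 2%:R * b.
Let al0 : 0 < al. Proof. by rewrite /al; move: hab; lra. Qed.
Let p0 : 0 < 1 - b. Proof. by move: ha hab; lra. Qed.
Let A0 : 0 < 3%:R / 2%:R - a - b. Proof. by move: hab; lra. Qed.
Let h0 : 0 < (2^-1 : R). Proof. by rewrite invr_gt0. Qed.

Let q01 : 0 <= t ^+ 2 < 1.
Proof. by rewrite sqr_ge0/= -real_normK ?num_real// expr_lt1. Qed.

Let q1 : `|t ^+ 2| < 1.
Proof. by have /andP[q0 q1] := q01; rewrite ger0_norm. Qed.

Let k : R := 2%:R * (1 - t ^+ 2) `^ (a + b - 1).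
Let k0 : 0 < k.
Proof. by rewrite mulr_gt0// powR_gt0// subr_gt0; have /andP[] := q01. Qed.

Lemma Rintegral_even_weight_moment (m : nat) :
  mu.-integrable `]0, 1[ (EFin \o (fun x => even_weight a b (t ^+ 2) x * x ^+ m.*2)) /\
  \int[mu]_(v in `]0, 1[) (beta_weight (1 - b) (2^-1 + m%:R) v *
     (1 - t ^+ 2 * v) `^ (- (3%:R / 2%:R - a - b + m%:R))) =
  2%:R * (1 - t ^+ 2) `^ (a + b - 1) *
  \int[mu]_(x in `]0, 1[) (even_weight a b (t ^+ 2) x * x ^+ m.*2).
Proof.
have Am : 0 < 3%:R / 2%:R - a - b + m%:R by rewrite ltr_wpDr.
have hm : 0 < (2^-1 : R) + m%:R by rewrite ltr_wpDr.
have [iw _] := Rintegral_binomial Am q1 (integrable_beta_weight p0 hm).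
apply: (Rintegral_of_integral_scale _ k0 _ _ iw) => //.
- by apply: measurable_funM; [exact: measurable_even_weight|measurability].
- move=> x _; rewrite mulr_ge0 ?even_weight_ge0//.
  by rewrite exprn_even_ge0// odd_double.
- exact: integral_even_weight_moment.
Qed.

Lemma integrable_even_weight :
  mu.-integrable `]0, 1[ (EFin \o even_weight a b (t ^+ 2)).
Proof.
have [+ _] := Rintegral_even_weight_moment 0; apply: eq_integrable => // x _ /=.
by rewrite double0 expr0 mulr1.
Qed.

Lemma integrable_folded : mu.-integrable `]0, 1[ (EFin \o (fun x =>
   even_weight a b (t ^+ 2) x * ((1 - s * x) `^ (- al) + (1 + s * x) `^ (- al)))).
Proof.
have s1' : `|- s| < 1 by rewrite normrN.
have [i1 _] := Rintegral_binomial al0 s1 integrable_even_weight.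
have [i2 _] := Rintegral_binomial al0 s1' integrable_even_weight.
have h := fun mD => integrableD mD i1 i2.
have := h (measurable_itv _); apply: eq_integrable => // x _ /=.
by rewrite -EFinD -mulrDr mulNr opprK.
Qed.

(** Up to a factor independent of m, the m-th term is the moment of order 2m times
    the term of degree 2m in s of (1 - s)^-al + (1 + s)^-al. *)
Lemma appellF1_series_folded :
  appellF1_series (3%:R / 2%:R - a - b) (1 - a - b) (1 - b) (3%:R / 2%:R - b)
    (s ^+ 2) (t ^+ 2) =
  (1 - t ^+ 2) `^ (a + b - 1) / Beta (1 - b) 2^-1 * folded_integral a b s t.
Proof.
have B0 : 0 < 1 - a - b by move: hab; lra.
rewrite appellF1_series_dual//; last by lra.
have -> : 3%:R / 2%:R - b - (1 - b) = 2^-1 :> R by field.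
have s1' : `|- s| < 1 by rewrite normrN.
have [i1 h1] := Rintegral_binomial al0 s1 integrable_even_weight.
have [i2 h2] := Rintegral_binomial al0 s1' integrable_even_weight.
have h := even_series_cvg h1 h2.
have -> : folded_integral a b s t =
    \int[mu]_(x in `]0, 1[) (even_weight a b (t ^+ 2) x * (1 - s * x) `^ (- al)) +
    \int[mu]_(x in `]0, 1[) (even_weight a b (t ^+ 2) x * (1 - - s * x) `^ (- al)).
  have sumE := fun mD => RintegralD mD i1 i2.
  rewrite -(sumE (measurable_itv _)); apply: eq_Rintegral => x _.
  by rewrite mulNr opprK mulrDr.
apply/cvg_lim => //; move: h; apply: series_scale_cvg => m.
have [_ ->] := Rintegral_even_weight_moment m.
have := binomial_coeff_double m al0.
have -> : (al + 1) / 2%:R = 3%:R / 2%:R - a - b by rewrite /al; field.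
have -> : al / 2%:R = 1 - a - b by rewrite /al; field.
move=> ->; rewrite -exprM mul2n /k; ring.
Qed.

End LeftHandSide.

(** The zeroth moment at t = 0. *)
Lemma Beta_half_folded a b : 0 < a -> a + b < 1 ->
  Beta (1 - b) 2^-1 = folded_integral a b 0 0.
Proof.
move=> ha hab; have z1 : `|0 : R| < 1 by rewrite normr0.
have [_ E] := Rintegral_even_weight_moment ha hab z1 0.
have iw := integrable_even_weight ha hab z1.
have -> : Beta (1 - b) 2^-1 = \int[mu]_(v in `]0, 1[)
    (beta_weight (1 - b) (2^-1 + 0%:R) v *
     (1 - 0 ^+ 2 * v) `^ (- (3%:R / 2%:R - a - b + 0%:R))).
  apply: eq_Rintegral => v _.
  by rewrite addr0 expr0n mul0r subr0 powR1 mulr1.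
rewrite E expr0n subr0 powR1 mulr1 -RintegralZl//; last first.
  by move: iw; apply: eq_integrable => // x _; rewrite /= expr0n double0 expr0 mulr1.
apply: eq_Rintegral => x _.
rewrite !mul0r subr0 addr0 powR1 double0 expr0n expr0 mulr1; ring.
Qed.

End EvenPart.

(** * The right-hand side as a folded integral *)

Section Folding.
Variable R : realType.
Implicit Types (a b s t x v : R).
Local Notation mu := (@lebesgue_measure R).

Lemma ge0_integral_fold (h : R -> R) :
  measurable_fun setT h -> (forall x, 0 <= h x) ->
  (forall x, 0 < x < 1 -> {for - x, continuous h}) ->
  (\int[mu]_(x in `](-1)%R, 1%R[) (h x)%:E =
   \int[mu]_(x in `]0%R, 1%R[) (h (- x) + h x)%:E)%E.
Proof.
move=> mh h0 ch.
have in01 x : (`]0, 1[%classic : set R) x -> 0 < x < 1 by rewrite /= in_itv.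
have im : -%R @` `]0, 1[ = (`]-1, 0[%classic : set R).
  apply/seteqP; split => [_ [x /in01 x01 <-]|x /=].
    by rewrite /= in_itv/=; move: x01; lra.
  by rewrite in_itv/= => x01; exists (- x); rewrite ?opprK//= in_itv/=; move: x01; lra.
have dF x : (`]0, 1[%classic : set R) x -> is_derive x 1 -%R (-1 : R).
  by move=> _; exact: is_deriveNid.
have refl : (\int[mu]_(x in `](-1)%R, 0%R[) (h x)%:E =
    \int[mu]_(x in `]0%R, 1%R[) (h (- x))%:E)%E.
  rewrite -im (ge0_substitution (segment_exhausted_oo (@ltr01 R)) dF (G := h)).
  - by apply: eq_integral => x _; rewrite normrN1 mulr1.
  - by move=> x _; exact: continuous_at_cst.
  - by right => x _; rewrite oppr_lt0.
  - by move=> x /in01; exact: ch.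
  - by move=> x _; exact: h0.
have mhE D : measurable_fun D (fun x => (h x)%:E).
  by apply/measurable_EFinP; exact: measurable_funTS.
have -> : (`]-1, 1[%classic : set R) = `]-1, 0[ `|` `[0, 1[.
  apply/seteqP; split => [x /=|x [] /=]; rewrite !in_itv/=.
  - move=> /andP[x1 x2]; have [x0|x0] := ltP x 0; [left|right].
      by rewrite x1.
    by rewrite x2.
  - by lra.
  - by lra.
rewrite ge0_integral_setU//=.
- rewrite refl -(@integral_itv_obnd_cbnd R 0); last exact: mhE.
  rewrite -ge0_integralD//.
  + by move=> x _; rewrite lee_fin h0.
  + by apply/measurable_EFinP; apply: (measurableT_comp mh); measurability.
  + by move=> x _; rewrite lee_fin h0.
  + exact: mhE.
- exact: mhE.
- by move=> x _; rewrite lee_fin h0.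
- rewrite disj_set2E; apply/eqP; rewrite -subset0 => x []/=.
  by rewrite !in_itv/= => /andP[_ x0]; rewrite leNgt x0.
Qed.

(** With v = (1 - w)/2 and w = (x + t)/(1 + t x) each base splits into linear
    factors in x:
<<
      v                   = (1-t)(1-x) / (2(1+tx))
      1 - v               = (1+t)(1+x) / (2(1+tx))
      1 + 4tv/(1-t)^2     = (1+t)(1-tx) / ((1-t)(1+tx))
      1 - 2(s-t)v/((1-t)(1+s)) = (1+t)(1+sx) / ((1+s)(1+tx))
>>
    The total power of 1 + t x is -a, equal to that of 1 - t x, so the weight is
    even apart from (1 + s x)^-al. *)
Lemma integral_moebius_fold a b s t : 0 <= t < 1 -> 0 <= s < 1 ->
  let al := 2%:R - 2%:R * a - 2%:R * b in
  (\int[mu]_(v in `]0%R, 1%R[) (beta_weight (1 - b) (1 - b) v *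
     (1 - - (4%:R * t / (1 - t) ^+ 2) * v) `^ (- a) *
     (1 - 2%:R * (s - t) / ((1 - t) * (1 + s)) * v) `^ (- al))%:E =
  (2%:R `^ (2%:R * b - 1) * (1 - t ^+ 2) `^ (a + b - 1) *
     (1 - t) `^ (2%:R - 2%:R * b) * (1 + s) `^ al)%:E *
  \int[mu]_(x in `]0%R, 1%R[) (even_weight a b (t ^+ 2) x *
    ((1 - s * x) `^ (- al) + (1 + s * x) `^ (- al)))%:E)%E.
Proof.
move=> /andP[t0 t1] /andP[s0 s1] al.
pose g x := even_weight a b (t ^+ 2) x * (1 + s * x) `^ (- al).
have inD x : (`]-1, 1[%classic : set R) x -> -1 < x < 1 by rewrite /= in_itv.
have -> : (\int[mu]_(x in `]0%R, 1%R[) (even_weight a b (t ^+ 2) x *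
    ((1 - s * x) `^ (- al) + (1 + s * x) `^ (- al)))%:E =
    \int[mu]_(x in `](-1)%R, 1%R[) (g x)%:E)%E.
  rewrite ge0_integral_fold.
  - apply: eq_integral => x _; congr EFin.
    by rewrite /g /even_weight sqrrN mulrN mulrDr.
  - by rewrite /g; apply: measurable_funM; [exact: measurable_even_weight|measurability].
  - by move=> x; rewrite mulr_ge0 ?even_weight_ge0 ?powR_ge0.
  - move=> x /andP[x0 x1]; rewrite /g /even_weight; continuity; rewrite ?sqrrN.
    + by rewrite subr_gt0 expr_lt1// ltW.
    + have tx : 0 <= t * x by rewrite mulr_ge0// ltW.
      by rewrite subr_gt0 -exprMn expr_lt1//; nra.
    + by nra.
have t1' : 0 < 1 - t by rewrite subr_gt0.
have t1p : 0 < 1 + t by rewrite ltr_pwDl.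
have s1p : 0 < 1 + s by rewrite ltr_pwDl.
pose F x := ((1 - t) + (- (1 - t)) * x) / (2%:R + 2%:R * t * x).
have den x : -1 < x < 1 -> 0 < 1 + t * x by move=> /andP[x0 x1]; nra.
have denm x : -1 < x < 1 -> 0 < 1 - t * x by move=> /andP[x0 x1]; nra.
have dens x : -1 < x < 1 -> 0 < 1 + s * x by move=> /andP[x0 x1]; nra.
have FE x : -1 < x < 1 -> F x = (1 - t) * (1 - x) * (2%:R^-1 * (1 + t * x)^-1).
  by move=> /den d0; rewrite /F; field; rewrite gt_eqF//=; lra.
have F1E x : -1 < x < 1 -> 1 - F x = (1 + t) * (1 + x) * (2%:R^-1 * (1 + t * x)^-1).
  by move=> x1; have d0 := den _ x1; rewrite FE//; field; rewrite gt_eqF.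
have E1 x : -1 < x < 1 -> 1 - - (4%:R * t / (1 - t) ^+ 2) * F x =
    (1 + t) * (1 - t * x) * ((1 - t)^-1 * (1 + t * x)^-1).
  by move=> x1; have d0 := den _ x1; rewrite FE//; field; rewrite !gt_eqF.
have E2 x : -1 < x < 1 -> 1 - 2%:R * (s - t) / ((1 - t) * (1 + s)) * F x =
    (1 + t) * (1 + s * x) * ((1 + s)^-1 * (1 + t * x)^-1).
  by move=> x1; have d0 := den _ x1; rewrite FE//; field; rewrite !gt_eqF.
have F01 x : -1 < x < 1 -> 0 < F x < 1.
  move=> x1; have d0 := den _ x1; rewrite -[F x < 1]subr_gt0 F1E// FE//; have /andP[x2 x3] := x1.
  by rewrite !mulr_gt0 ?invr_gt0//; lra.
have im : F @` `]-1, 1[ = `]0, 1[%classic.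
  apply/seteqP; split => [_ [x /inD /F01 F01x <-]|v /=]; first by rewrite /= in_itv.
  rewrite in_itv/= => /andP[v0 v1].
  have d0 : 0 < 1 - t + 2%:R * t * v by nra.
  (* the inverse automorphism (w - t)/(1 - t w) at w = 1 - 2 v *)
  exists ((1 - t - 2%:R * v) / (1 - t + 2%:R * t * v)).
    by rewrite /= in_itv/= ltr_pdivlMr// ltr_pdivrMr//; apply/andP; split; nra.
  set x := _ / _; have xE : 1 + t * x = (1 - t) * (1 + t) / (1 - t + 2%:R * t * v).
    by rewrite /x; field; rewrite gt_eqF.
  have -> : F x = (1 - t) * (1 - x) / (2%:R * (1 + t * x)).
    by rewrite /F; congr (_ / _); ring.
  rewrite xE /x; field; rewrite !gt_eqF//=.
pose f x := ((- (1 - t)) * 2%:R - (1 - t) * (2%:R * t)) / (2%:R + 2%:R * t * x) ^+ 2.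
have den2 x : -1 < x < 1 -> 0 < 2%:R + 2%:R * t * x by move=> /den; lra.
have dF x : (`]-1, 1[%classic : set R) x -> is_derive x 1 F (f x).
  by move=> /inD/den2 d0; apply: is_derive_moebius; rewrite gt_eqF.
have fE x : -1 < x < 1 -> f x = - ((1 - t) * (1 + t) * 2%:R^-1 * (1 + t * x) `^ (- 2%:R)).
  move=> /den d0; rewrite powR_invn ?ltW// /f; field.
  by rewrite gt_eqF//= gt_eqF//; lra.
have fpos x : -1 < x < 1 ->
    0 < (1 - t) * (1 + t) * 2%:R^-1 * (1 + t * x) `^ (- 2%:R).
  by move=> /den d0; rewrite !mulr_gt0 ?invr_gt0 ?powR_gt0.
have m11 : (-1 : R) < 1 by lra.
rewrite -[X in (\int[mu]_(v in X) _)%E = _]im.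
rewrite (ge0_substitution (segment_exhausted_oo m11) dF (G := fun v =>
  beta_weight (1 - b) (1 - b) v *
     (1 - - (4%:R * t / (1 - t) ^+ 2) * v) `^ (- a) *
     (1 - 2%:R * (s - t) / ((1 - t) * (1 + s)) * v) `^ (- al))).
- rewrite -ge0_integralZl_EFin//=; last 3 first.
  + by move=> x _; rewrite lee_fin /g mulr_ge0 ?even_weight_ge0 ?powR_ge0.
  + apply/measurable_EFinP; apply: measurable_funM; last by measurability.
    exact: measurable_even_weight.
  + by rewrite !mulr_ge0 ?powR_ge0.
  apply: eq_integral => x; rewrite inE => /inD x1.
  have d1 := den _ x1; have d2 := denm _ x1; have d3 := dens _ x1.
  have [x2 x3] := andP x1.
  have x4 : 0 < 1 - x by lra.
  have x5 : 0 < 1 + x by lra.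
  rewrite -EFinM; congr EFin.
  rewrite fE// normrN gtr0_norm ?fpos// /beta_weight /g /even_weight.
  rewrite E1// E2// F1E// FE//.
  have -> : 1 - t ^+ 2 = (1 - t) * (1 + t) by ring.
  have -> : 1 - x ^+ 2 = (1 - x) * (1 + x) by ring.
  have -> : 1 - t ^+ 2 * x ^+ 2 = (1 - t * x) * (1 + t * x) by ring.
  rewrite -[2%:R^-1]powR_inv1//.
  have -> : (1 - t) * (1 + t) * 2%:R `^ (-1) * (1 + t * x) `^ (- 2%:R) =
    (1 - t) `^ 1 * (1 + t) `^ 1 * 2%:R `^ (-1) * (1 + t * x) `^ (- 2%:R).
    by rewrite !powRr1 ?ltW.
  rewrite /al.
  rewrite !powR_expR ?mulr_gt0 ?invr_gt0 ?expR_gt0//.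
  rewrite !lnM ?posrE ?mulr_gt0 ?invr_gt0 ?expR_gt0// !lnV ?posrE// ?expRK.
  by rewrite -!expRD; congr expR; ring.
- move=> x /inD/den2 d0; rewrite /f.
  by continuity; rewrite expf_neq0// gt_eqF.
- by right => x /inD x1; rewrite fE// oppr_lt0 fpos.
- move=> x /inD x1; have /andP[v0 v1] := F01 _ x1; rewrite /beta_weight.
  have d1 := den _ x1; have d2 := denm _ x1; have d3 := dens _ x1.
  continuity => //.
  + by rewrite subr_gt0.
  + by rewrite E1// !mulr_gt0 ?invr_gt0.
  + by rewrite E2// !mulr_gt0 ?invr_gt0.
- by move=> x _; rewrite !mulr_ge0 ?beta_weight_ge0 ?powR_ge0.
Qed.

End Folding.

(** * Normalizing constants and the transformation *)

Section Constants.
Variable R : realType.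
Implicit Types (a b s t : R).
Local Notation mu := (@lebesgue_measure R).

Lemma Rintegral_moebius_fold a b s t : 0 < a -> a + b < 1 ->
  0 <= t < 1 -> 0 <= s < 1 ->
  let al := 2%:R - 2%:R * a - 2%:R * b in
  \int[mu]_(v in `]0, 1[) (beta_weight (1 - b) (1 - b) v *
     (1 - - (4%:R * t / (1 - t) ^+ 2) * v) `^ (- a) *
     (1 - 2%:R * (s - t) / ((1 - t) * (1 + s)) * v) `^ (- al)) =
  2%:R `^ (2%:R * b - 1) * (1 - t ^+ 2) `^ (a + b - 1) *
     (1 - t) `^ (2%:R - 2%:R * b) * (1 + s) `^ al * folded_integral a b s t.
Proof.
move=> ha hab t01 s01 al.
have nlt x : 0 <= x < 1 -> `|x| < 1 :> R by move=> /andP[x0 x1]; rewrite ger0_norm.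
have iQ := integrable_folded ha hab (nlt _ s01) (nlt _ t01).
have E := integral_moebius_fold a b t01 s01.
by rewrite [in LHS]/Rintegral E fineM// integrable_fin_num.
Qed.

(** The case s = t = 0, where all bases but v and 1 - v equal 1. *)
Lemma Beta_folded a b : 0 < a -> a + b < 1 ->
  Beta (1 - b) (1 - b) = 2%:R `^ (2%:R * b - 1) * folded_integral a b 0 0.
Proof.
move=> ha hab; have z1 : 0 <= (0 : R) < 1 by rewrite lexx ltr01.
have := Rintegral_moebius_fold ha hab z1 z1.
rewrite /= expr0n subr0 addr0 !powR1 !mulr1 => <-.
apply: eq_Rintegral => v _.
by rewrite !(addr0, mulr0, mul0r, oppr0, subr0, powR1, mulr1).
Qed.

End Constants.

Theorem theorem6p1 (R : realType) (a b s t : R)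
  (ha : 0 < a) (hab : a + b < 1) (ht0 : 0 < t) (ht1 : t < 1)
  (hts : t < s) (hs1 : s < 1) :
  appellF1 (3%:R / 2%:R - a - b) (1 - a - b) (1 - b) (3%:R / 2%:R - b)
    (s ^+ 2) (t ^+ 2)
  = ((1 - t) `^ (2%:R * b - 2%:R) * (1 + s) `^ (2%:R * a + 2%:R * b - 2%:R))
    * appellF1 (1 - b) a (2%:R - 2%:R * a - 2%:R * b) (2%:R - 2%:R * b)
        (- (4%:R * t / (1 - t) ^+ 2))
        (2%:R * (s - t) / ((1 - t) * (1 + s))).
Proof.
have hs0 : 0 < s by exact: lt_trans hts.
have hb : 0 < 1 - b by move: ha hab; lra.
have lt1 (x : R) : 0 < x -> x < 1 -> `|x| < 1 by move=> x0 x1; rewrite gtr0_norm.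
have s1 := lt1 _ hs0 hs1; have t1 := lt1 _ ht0 ht1.
have sq1 (x : R) : `|x| < 1 -> `|x ^+ 2| < 1 by move=> x1; rewrite normrX expr_lt1.
rewrite [LHS]/appellF1 (sq1 _ s1) (sq1 _ t1)/= appellF1_series_folded//.
set al := 2%:R - 2%:R * a - 2%:R * b.
set X := - (4%:R * t / _); set Y := 2%:R * (s - t) / _.
have al0 : 0 < al by rewrite /al; move: hab; lra.
have -> : appellF1 (1 - b) a al (2%:R - 2%:R * b) X Y =
    appellF1_integral (1 - b) a al (2%:R - 2%:R * b) X Y.
  rewrite /appellF1; case: ifPn => // /andP[X1 Y1].
  by rewrite appellF1_series_integral//; lra.
have cA : 2%:R - 2%:R * b - (1 - b) = 1 - b by ring.
rewrite /appellF1_integral cA.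
have -> : \int[lebesgue_measure]_(u in `]0, 1[) (u `^ (1 - b - 1) *
    (1 - u) `^ (1 - b - 1) * (1 - X * u) `^ (- a) * (1 - Y * u) `^ (- al)) =
    2%:R `^ (2%:R * b - 1) * (1 - t ^+ 2) `^ (a + b - 1) *
     (1 - t) `^ (2%:R - 2%:R * b) * (1 + s) `^ al * folded_integral a b s t.
  by apply: Rintegral_moebius_fold => //; rewrite ?(ltW ht0) ?(ltW hs0).
have -> : Gamma (2%:R - 2%:R * b) / (Gamma (1 - b) * Gamma (1 - b)) =
    (Beta (1 - b) (1 - b))^-1.
  by rewrite Beta_Gamma// invf_div; have -> : 1 - b + (1 - b) = 2%:R - 2%:R * b by ring.
rewrite (Beta_folded ha hab) (Beta_half_folded ha hab).
have Q0 : folded_integral a b 0 0 != 0.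
  by rewrite -Beta_half_folded// gt_eqF// Beta_gt0// invr_gt0.
have c0 : 2%:R `^ (2%:R * b - 1) != 0 :> R by rewrite gt_eqF// powR_gt0.
have C1 : (1 - t) `^ (2%:R * b - 2%:R) * (1 - t) `^ (2%:R - 2%:R * b) = 1.
  rewrite -powRD; last by apply/implyP => _; rewrite gt_eqF// subr_gt0.
  have -> : 2%:R * b - 2%:R + (2%:R - 2%:R * b) = 0 by ring.
  by rewrite powRr0.
have C2 : (1 + s) `^ (2%:R * a + 2%:R * b - 2%:R) * (1 + s) `^ al = 1.
  rewrite -powRD; last by apply/implyP => _; rewrite gt_eqF// addr_gt0.
  have -> : 2%:R * a + 2%:R * b - 2%:R + al = 0 by rewrite /al; ring.
  by rewrite powRr0.
move: C1 C2 Q0 c0.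
move: ((1 - t) `^ (2%:R * b - 2%:R)) ((1 - t) `^ (2%:R - 2%:R * b))
  ((1 + s) `^ (2%:R * a + 2%:R * b - 2%:R)) ((1 + s) `^ al)
  (folded_integral a b 0 0) (2%:R `^ (2%:R * b - 1)) (folded_integral a b s t)
  ((1 - t ^+ 2) `^ (a + b - 1)).
move=> u1 u2 v1 v2 Q c Qst d C1 C2 Q0 c0.
have -> : u1 * v1 * ((c * Q)^-1 * (c * d * u2 * v2 * Qst)) =
  (u1 * u2) * (v1 * v2) * ((c * Q)^-1 * (c * d * Qst)) by ring.
by rewrite C1 C2; field; rewrite Q0 c0.
Qed.
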